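(* Let the nonlinear system $\dot{\mathbf{x}}=\mathbf{F}(\mathbf{x})$ on $\mathbb{R}^n$ possess a stable equilibrium point $\mathbf{x}^\ast$ with basin of attraction $\mathbb{B}(\mathbf{x}^\ast)$, under the standing assumptions and with the Koopman eigenvalues, eigenfunctions, modes, participation factors and generalized participations specified in the context. For $\mathbf{x}^0\in\mathbb{B}(\mathbf{x}^\ast)$ and $\delta\mathbf{x}\in\mathbb{R}^n$ with $\mathbf{x}^0+\delta\mathbf{x}\in\mathbb{B}(\mathbf{x}^\ast)$ put $$\mathrm{d}x_k(t;\mathbf{x}^0,\delta\mathbf{x}):=\bar x_k(t;\mathbf{x}^0+\delta\mathbf{x})-\bar x_k(t;\mathbf{x}^0),\qquad \mathrm{d}z_j(t;\mathbf{x}^0,\delta\mathbf{x}):=\phi_j(\mathbf{S}^t(\mathbf{x}^0+\delta\mathbf{x}))-\phi_j(\mathbf{S}^t(\mathbf{x}^0)),$$ $$\delta z_j^0:=\phi_j(\mathbf{x}^0+\delta\mathbf{x})-\phi_j(\mathbf{x}^0),\qquad \delta z^0_{\langle j_1\cdots j_n\rangle}:=\phi_{\langle j_1\cdots j_n\rangle}(\mathbf{x}^0+\delta\mathbf{x})-\phi_{\langle j_1\cdots j_n\rangle}(\mathbf{x}^0).$$ Then, for all $\mathbf{x}^0\in\mathbb{B}(\mathbf{x}^\ast)$, all $t\ge 0$ and all $k,j\in\{1,\ldots,n\}$, under an infinitesimal change $\delta\mathbf{x}$, $$\begin{aligned}\mathrm{d}x_k(t;\mathbf{x}^0,\delta\mathbf{x})\approx{}&\sum_{j=1}^n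 e^{\lambda_j t}P_j^k(\mathbf{x}^0)\,\delta x_k+\sum_{\substack{\ell=1\\ \ell\ne k}}^n\sum_{j=1}^n e^{\lambda_j t}P_j^{k(\ell)}(\mathbf{x}^0)\,\delta x_\ell\\&+\sum_{\substack{j_1,\ldots,j_n\in\mathbb{N}_0\\ j_1+\cdots+j_n>1}}e^{(j_1\lambda_1+\cdots+j_n\lambda_n)t}P^k_{\langle j_1\cdots j_n\rangle}(\mathbf{x}^0)\,\delta x_k\\&+\sum_{\substack{\ell=1\\ \ell\ne k}}^n\ \sum_{\substack{j_1,\ldots,j_n\in\mathbb{N}_0\\ j_1+\cdots+j_n>1}}e^{(j_1\lambda_1+\cdots+j_n\lambda_n)t}P^{k(\ell)}_{\langle j_1\cdots j_n\rangle}(\mathbf{x}^0)\,\delta x_\ell,\end{aligned}$$ $$\begin{aligned}\mathrm{d}z_j(t;\mathbf{x}^0,\delta\mathbf{x})\approx{}&e^{\lambda_j t}\sum_{k=1}^n P_j^k(\mathbf{x}^0)\,\delta z_j^0+e^{\lambda_j t}\sum_{\substack{i=1\\ i\neq j}}^n\sum_{k=1}^n P^k_{i(j)}(\mathbf{x}^0)\,\delta z_i^0\\&+e^{\lambda_j t}\sum_{\substack{j_1,\ldots,j_n\in\mathbb{N}_0\\ j_1+\cdots+j_n>1}}\ \sum_{k=1}^n P^k_{\langle j_1\cdots j_n\rangle(j)}(\mathbf{x}^0)\,\delta z^0_{\langle j_1\cdots j_n\rangle}.\end{aligned}$$ Here, for fixed $\mathbf{x}^0$ and $t$, $\approx$ means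 that the two sides differ by a term that is $\mathcal{O}(\|\delta\mathbf{x}\|^2)$ as $\delta\mathbf{x}\to\mathbf{0}$.
   Context: Setting. $\mathbf{F}:\mathbb{R}^n\to\mathbb{R}^n$ is analytic; for each initial condition $\mathbf{x}^0$ the solution $\bar{\mathbf{x}}(t;\mathbf{x}^0)=\mathbf{S}^t(\mathbf{x}^0)$, $t\ge0$, exists and is unique. $\mathbf{x}^\ast$ is an asymptotically stable equilibrium with (open) basin of attraction $\mathbb{B}(\mathbf{x}^\ast)\subseteq\mathbb{R}^n$. The Jacobian matrix of $\mathbf{F}$ at $\mathbf{x}^\ast$ has $n$ distinct eigenvalues $\lambda_1,\ldots,\lambda_n$ with strictly negative real parts, which are non-resonant: there is no $(j_1,\ldots,j_n)\in\mathbb{Z}^n\setminus\{\mathbf{0}\}$ with $j_1\lambda_1+\cdots+j_n\lambda_n=0$. $\mathbb{N}_0=\mathbb{N}\cup\{0\}$; the $k$-th element of an indexed vector $\mathbf{V}_j$ is written $V_{jk}$. Koopman eigenfunctions. The Koopman operators are $\mathcal{U}^tf=f\circ\mathbf{S}^t$, acting on observables $f:\mathbb{B}(\mathbf{x}^\ast)\to\mathbb{C}$. $\phi_1,\ldots,\phi_n$ are the (not identically zero) Koopman principal eigenfunctions, smooth on $\mathbb{B}(\mathbf{x}^\ast)$, with $\phi_j(\mathbf{S}^t(\mathbf{x}))=e^{\lambda_jt}\phi_j(\mathbf{x})$ for all $t\ge0$ (their existence is a known fact). The map $\mathbf{h}=(\phi_1,\ldots,\phi_n)^\top:\mathbb{B}(\mathbf{x}^\ast)\to\mathbb{C}^n$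 is a conjugacy on the whole basin, $\mathbf{h}\circ\mathbf{S}^t=\exp(\mathbf{D}t)\circ\mathbf{h}$ with $\mathbf{D}=\mathrm{diag}(\lambda_1,\ldots,\lambda_n)$. For $j_1,\ldots,j_n\in\mathbb{N}_0$ with $j_1+\cdots+j_n>1$, put $\phi_{\langle j_1\cdots j_n\rangle}(\mathbf{x}):=\phi_1(\mathbf{x})^{j_1}\cdots\phi_n(\mathbf{x})^{j_n}$; this is a Koopman eigenfunction with eigenvalue $j_1\lambda_1+\cdots+j_n\lambda_n$. Space of observables and Koopman modes. The space $\mathscr{F}$ of observables is the modulated Segal–Bargmann space: functions $f=g\circ\mathbf{h}$ with $g:\mathbb{C}^n\to\mathbb{C}$ entire and $\frac{1}{\pi^n}\int_{\mathbb{C}^n}|g(\mathbf{z})|^2e^{-|\mathbf{z}|^2}\,\mathrm{d}\mathbf{z}<\infty$. The coordinate observables $f(\mathbf{x})=x_k$ belong to $\mathscr{F}$, and (known fact, the Koopman mode decomposition) for all $\mathbf{x}^0\in\mathbb{B}(\mathbf{x}^\ast)$ and $t\ge0$ $$\bar{\mathbf{x}}(t;\mathbf{x}^0)=\mathbf{x}^\ast+\sum_{j=1}^n e^{\lambda_jt}\phi_j(\mathbf{x}^0)\mathbf{V}_j+\sum_{\substack{j_1,\ldots,j_n\in\mathbb{N}_0\\ j_1+\cdots+j_n>1}}e^{(j_1\lambda_1+\cdots+j_n\lambda_n)t}\phi_{\langle j_1\cdots j_n\rangle}(\mathbf{x}^0)\mathbf{V}_{\langle j_1\cdots j_n\rangle},$$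 where the vectors $\mathbf{V}_j,\mathbf{V}_{\langle j_1\cdots j_n\rangle}\in\mathbb{C}^n$ (Koopman modes) are the uniquely determined coefficients of this expansion. Participation factors (PFs) and generalized participations (GPs). For $i,j,k,\ell\in\{1,\ldots,n\}$: $$P_j^k(\mathbf{x}):=\frac{\partial\phi_j}{\partial x_k}(\mathbf{x})V_{jk},\quad P_j^{k(\ell)}(\mathbf{x}):=\frac{\partial\phi_j}{\partial x_\ell}(\mathbf{x})V_{jk},\quad P_{i(j)}^k(\mathbf{x}):=\frac{\partial\phi_j}{\partial x_k}(\mathbf{x})V_{ik},$$ and for the higher-order eigenfunctions $$P^k_{\langle j_1\cdots j_n\rangle}(\mathbf{x}):=\frac{\partial\phi_{\langle j_1\cdots j_n\rangle}}{\partial x_k}(\mathbf{x})V_{\langle j_1\cdots j_n\rangle k},\quad P^{k(\ell)}_{\langle j_1\cdots j_n\rangle}(\mathbf{x}):=\frac{\partial\phi_{\langle j_1\cdots j_n\rangle}}{\partial x_\ell}(\mathbf{x})V_{\langle j_1\cdots j_n\rangle k},\quad P^k_{\langle j_1\cdots j_n\rangle(j)}(\mathbf{x}):=\frac{\partial\phi_j}{\partial x_k}(\mathbf{x})V_{\langle j_1\cdots j_n\rangle k}.$$ *)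

(* Defs.v *)
(* MathComp-Analysis, with complex numbers R[i] over a realType R *)
From HB Require Import structures.
From mathcomp Require Import all_boot all_order all_algebra.
From mathcomp Require Import finmap complex.
From mathcomp Require Import all_classical all_reals all_analysis.
From mathcomp.analysis.showcase Require Export summability.

Set Implicit Arguments.
Unset Strict Implicit.
Unset Printing Implicit Defensive.
Import Order.TTheory GRing.Theory Num.Theory.
Import numFieldNormedType.Exports.

Local Open Scope classical_set_scope.
Local Open Scope complex_scope.
Local Open Scope ring_scope.

(* Series over multi-indices are understood as unconditional sums, i.e. as
   limits of [partial_sum] along the filter [totally] of finite index sets;
   in finite dimension this is the same as absolute convergence. *)
Notation mindex n := {ffun 'I_n -> nat}.
Notation hindex n := {a : mindex n | (1 < \sum_(i < n) a i)%N} (only parsing).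

(* R[i] with the topology of its modulus *)
HB.instance Definition _ (R : realType) := PseudoPointedMetric.copy R[i] R[i]^o.
HB.instance Definition _ (R : realType) := PseudoMetricNormedZmod.copy R[i] R[i]^o.

Section defs.
Variable R : realType.
Local Notation C := (R[i]).

Definition cexp (z : C) : C :=
  (expR (complex.Re z) * cos (complex.Im z)) +i*
  (expR (complex.Re z) * sin (complex.Im z)).

Definition sqmod (z : C) : R := complex.Re z ^+ 2 + complex.Im z ^+ 2.

Variable n : nat.
Local Notation state := 'rV[R]_n.
Local Notation cspace := 'rV[C]_n.
Implicit Types (F : state -> state) (S : R -> state -> state) (x xs : state).
Implicit Types (lam : 'I_n -> C) (phi : 'I_n -> state -> C).
Implicit Types (V : 'I_n -> cspace) (W : hindex n -> cspace) (B : set state).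

Definition analytic F := forall a : state, exists c : mindex n -> state,
  \forall x \near a,
    partial_sum (fun m : mindex n => (\prod_(i < n) (x - a) 0 i ^+ m i) *: c m)
      @ totally --> F x.

(* At t = 0 the derivative is one-sided: only times t + h >= 0 are used. *)
Definition solution F x (u : R -> state) :=
  u 0 = x /\
  forall t : R, 0 <= t ->
    h^-1 *: (u (t + h) - u t) @[h --> within [set h | 0 <= t + h] 0^']
      --> F (u t).

Definition flow F S := forall x, solution F x (S ^~ x) /\
  forall u, solution F x u -> forall t, 0 <= t -> u t = S t x.

Definition basin S xs : set state := [set x | S t x @[t --> +oo] --> xs].

Definition asymptotically_stable S xs :=
  (forall e : R, 0 < e -> exists2 d : R, 0 < d &
     forall x, `|x - xs| < d -> forall t : R, 0 <= t -> `|S t x - xs| < e) /\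
  (\forall x \near xs, basin S xs x).

Definition nonresonant lam := forall m : 'I_n -> int,
  (exists i, m i != 0) -> \sum_(i < n) (m i)%:~R * lam i != 0.

Definition koopman S (t : R) (f : state -> C) : state -> C := f \o S t.

Definition koopman_eigenfunction S B (mu : C) (f : state -> C) :=
  (exists2 x, B x & f x != 0) /\
  forall (t : R) x, 0 <= t -> B x -> koopman S t f x = cexp (mu * t%:C) * f x.

Fixpoint Ck_on B (k : nat) (f : state -> R) : Prop :=
  match k with
  | 0 => forall x, B x -> {for x, continuous f}
  | k'.+1 => (forall x, B x -> differentiable f x) /\
             forall i : 'I_n, Ck_on B k' (fun x => 'D_(delta_mx 0 i) f x)
  end.

(* Smoothness in the real sense; meant for open B. *)
Definition smooth_on B (f : state -> C) := forall k,
  Ck_on B k (fun x => complex.Re (f x)) /\ Ck_on B k (fun x => complex.Im (f x)).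

Definition hmap phi (x : state) : cspace := \row_j phi j x.

(* A homeomorphism of B onto its image that intertwines S^t with exp(D t). *)
Definition diagonal_conjugacy S B lam (h : state -> cspace) :=
  {within B, continuous h} /\
  (exists hinv : cspace -> state,
     (forall x : state, B x -> hinv (h x) = x) /\
     {within h @` B, continuous hinv}) /\
  (forall (t : R) (x : state), 0 <= t -> B x ->
     h (S t x) = h x *m diag_mx (\row_j cexp (lam j * t%:C))).

Definition entire (g : cspace -> C) :=
  forall z, differentiable (g : cspace -> C^o) z.

(* Lebesgue integral over C^m = R^2m of a nonnegative function, as an iterated
   integral (equal to the integral for the product measure by Tonelli). *)
Fixpoint integral_C (m : nat) : ('rV[C]_m -> \bar R) -> \bar R :=
  match m with
  | 0 => fun f => f 0
  | m'.+1 => fun f =>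
      (\int[lebesgue_measure]_x \int[lebesgue_measure]_y
         integral_C (fun w : 'rV[C]_m' =>
           f (row_mx (const_mx (x +i* y) : 'rV[C]_1) w)))%E
  end.

Definition segal_bargmann (g : cspace -> C) := entire g /\
  ((pi ^- n)%:E * integral_C (fun z : cspace =>
     (sqmod (g z) * expR (- \sum_(j < n) sqmod (z 0 j)))%:E) < +oo)%E.

Definition observable_space B (h : state -> cspace) (f : state -> C) :=
  exists2 g, segal_bargmann g & forall x, B x -> f x = g (h x).

Definition lam_h lam (a : hindex n) : C := \sum_(i < n) lam i *+ val a i.

Definition phi_h phi (a : hindex n) (x : state) : C :=
  \prod_(i < n) phi i x ^+ val a i.

(* V and W are the coefficients of the mode expansion of S t x0; the linear part
   has been moved to the limit side. *)
Definition koopman_modes S xs lam phi V W := forall x0 (t : R),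
  basin S xs x0 -> 0 <= t ->
  partial_sum (fun a : hindex n =>
      (cexp (lam_h lam a * t%:C) * phi_h phi a x0) *: W a) @ totally -->
    map_mx (real_complex R) (S t x0) - map_mx (real_complex R) xs
    - \sum_(j < n) (cexp (lam j * t%:C) * phi j x0) *: V j.

Definition pderiv (k : 'I_n) (f : state -> C) x : C :=
  ('D_(delta_mx 0 k) (fun y => complex.Re (f y) : R^o) x) +i*
  ('D_(delta_mx 0 k) (fun y => complex.Im (f y) : R^o) x).

(* P_j^k, P_j^{k(l)} and P_{i(j)}^k *)
Definition PF phi V (j k : 'I_n) x := pderiv k (phi j) x * V j 0 k.
Definition GP_state phi V (j k l : 'I_n) x := pderiv l (phi j) x * V j 0 k.
Definition GP_mode phi V (i j k : 'I_n) x := pderiv k (phi j) x * V i 0 k.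

(* P_<a>^k, P_<a>^{k(l)} and P_{<a>(j)}^k *)
Definition PFh phi W a (k : 'I_n) x := pderiv k (phi_h phi a) x * W a 0 k.
Definition GPh_state phi W a (k l : 'I_n) x :=
  pderiv l (phi_h phi a) x * W a 0 k.
Definition GPh_mode phi W a (j k : 'I_n) x := pderiv k (phi j) x * W a 0 k.

Definition dX S t x0 (k : 'I_n) (dx : state) : C :=
  (S t (x0 + dx) 0 k - S t x0 0 k)%:C.
Definition dZ S phi t x0 (j : 'I_n) (dx : state) : C :=
  phi j (S t (x0 + dx)) - phi j (S t x0).
Definition dz0 phi x0 (j : 'I_n) (dx : state) : C :=
  phi j (x0 + dx) - phi j x0.
Definition dz0_h phi x0 (a : hindex n) (dx : state) : C :=
  phi_h phi a (x0 + dx) - phi_h phi a x0.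

Definition summable_h (f : hindex n -> C) :=
  cvg (partial_sum (f : hindex n -> C^o) @ totally).
Definition sum_h (f : hindex n -> C) : C := sum (f : hindex n -> C^o).

(* The norm of dx is the sup norm of 'rV[R]_n. *)
Definition approx2 B x0 (f g : state -> C) := exists M : R,
  \forall dx \near (0 : state), B (x0 + dx) ->
    `|f dx - g dx| <= (M * `|dx| ^+ 2)%:C.

End defs.

(* Main.v *)
(* At t = 0 the mode expansion writes the increment dx exactly as a series in
   the increments of the eigenfunctions.  Inserting it into the differential of
   phi_j at x0 gives the expansion of dz_j, with no other error than the Taylor
   remainder of phi_j.

   For dx_k the series has to be differentiated term by term.  The coordinates
   are entire functions of h = (phi_1, ..., phi_n), so the matrix of partial
   derivatives of h is invertible and no phi_j has a vanishing gradient.  Since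
   phi_j has derivative lam_j phi_j along F with Re lam_j < 0, moving from x0
   slightly backwards along F, with a small generic real perturbation, gives a
   point y of the basin with |phi_j y| > |phi_j x0| for all j.  The mode
   expansion at y converges absolutely, hence the power series in h converges
   on a polydisc whose interior contains h x0, which allows differentiation
   term by term and bounds the remainder by O(|dx|^2). *)
Require Import Defs.
From mathcomp Require Import all_boot all_order all_algebra.
From mathcomp Require Import finmap complex.
From mathcomp Require Import all_classical all_reals all_analysis.
From mathcomp Require Import ring lra.

Import Order.TTheory GRing.Theory Num.Theory.
Import numFieldNormedType.Exports.

Local Open Scope classical_set_scope.
Local Open Scope complex_scope.
Local Open Scope ring_scope.

Set Implicit Arguments.
Unset Strict Implicit.
Unset Printing Implicit Defensive.

Local Notation normc := Normc.normc.

(* Declared in a section, this instance is not exported by its library. *)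
#[local] Existing Instance totally_filter.

(** * Unconditional sums of complex numbers *)

Section complex_modulus.
Variable R : realType.
Local Notation C := R[i].
Implicit Types (z w : C).

Lemma normcE z : `|z| = (normc z)%:C.
Proof. by []. Qed.

Lemma normc_ge0 z : 0 <= normc z.
Proof. by rewrite -lecR -normcE normr_ge0. Qed.

Lemma normcD z w : normc (z + w) <= normc z + normc w.
Proof. by rewrite -lecR rmorphD /= -!normcE ler_normD. Qed.

Lemma normcN z : normc (- z) = normc z.
Proof. by apply: complexI; rewrite -!normcE normrN. Qed.

Lemma normcB z w : normc (z - w) = normc (w - z).
Proof. by rewrite -normcN opprB. Qed.

Lemma normcR (x : R) : normc x%:C = `|x|.
Proof. by rewrite /= expr0n /= addr0 sqrtr_sqr. Qed.

Lemma normcX z k : normc (z ^+ k) = normc z ^+ k.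
Proof. by apply: complexI; rewrite rmorphXn /= -!normcE normrX. Qed.

Lemma normc_prod (I : Type) (r : seq I) (P : pred I) (F : I -> C) :
  normc (\prod_(i <- r | P i) F i) = \prod_(i <- r | P i) normc (F i).
Proof.
by apply: complexI; rewrite rmorph_prod /= -normcE normr_prod.
Qed.

Lemma normc_eq0 z : (normc z == 0) = (z == 0).
Proof.
by apply/eqP/eqP => [/Normc.eq0_normc //|->]; rewrite Normc.normc0.
Qed.

Lemma normc_sum (I : Type) (r : seq I) (P : pred I) (F : I -> C) :
  normc (\sum_(i <- r | P i) F i) <= \sum_(i <- r | P i) normc (F i).
Proof.
by rewrite -lecR rmorph_sum /= -normcE; apply: ler_norm_sum.
Qed.

Lemma Re_sum (I : Type) (r : seq I) (P : pred I) (F : I -> C) :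
  complex.Re (\sum_(i <- r | P i) F i) = \sum_(i <- r | P i) complex.Re (F i).
Proof.
by apply: (big_morph (@complex.Re R)) => // -[? ?] [].
Qed.

Lemma Im_sum (I : Type) (r : seq I) (P : pred I) (F : I -> C) :
  complex.Im (\sum_(i <- r | P i) F i) = \sum_(i <- r | P i) complex.Im (F i).
Proof.
by apply: (big_morph (@complex.Im R)) => // -[? ?] [].
Qed.

Lemma Re_le_normc z : `|complex.Re z| <= normc z.
Proof. by rewrite -lecR -normcE normc_ge_Re. Qed.

Lemma Im_le_normc z : `|complex.Im z| <= normc z.
Proof.
by case: z => a b /=; rewrite -sqrtr_sqr ler_wsqrtr // lerDr sqr_ge0.
Qed.

Lemma normc_le_ReIm z : normc z <= `|complex.Re z| + `|complex.Im z|.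
Proof.
case: z => a b /=; rewrite -[leRHS]ger0_norm ?addr_ge0 // -sqrtr_sqr.
rewrite ler_wsqrtr // sqrrD !real_normK ?num_real //.
by rewrite addrAC lerDl mulrn_wge0 // mulr_ge0.
Qed.

(** A positive element of [R[i]] has zero imaginary part, so the complex radii of the topology
    reduce to real ones and all later estimates can be made in [R]. *)
Lemma cvgCP {T : Type} {F : set_system T} {FF : Filter F} (u : T -> C) l :
  u @ F --> (l : C^o) <->
  forall e : R, 0 < e -> \forall x \near F, normc (u x - l) < e.
Proof.
split=> [/cvgrPdist_lt h e e0|h].
  have := h e%:C; rewrite ltcR => /(_ e0); apply: filterS => x.
  by rewrite distrC -ltcR.
apply/cvgrPdist_lt => -[e e'] /=; rewrite ltcE /= => /andP[/eqP -> e0].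
have := h e e0; apply: filterS => x.
by rewrite -ltcR -normcE distrC.
Qed.

Lemma cvg_complex {T : Type} {F : set_system T} {FF : Filter F} (u : T -> C) l :
  (fun x => complex.Re (u x)) @ F --> (complex.Re l : R) ->
  (fun x => complex.Im (u x)) @ F --> (complex.Im l : R) ->
  u @ F --> (l : C^o).
Proof.
move=> /cvgrPdist_lt hr /cvgrPdist_lt hi; apply/cvgCP => e e0.
have e20 : 0 < e / 2 by rewrite divr_gt0.
apply: filterS2 (hr _ e20) (hi _ e20) => x hr1 hi1.
apply: le_lt_trans (normc_le_ReIm _) _.
have -> : complex.Re (u x - l) = - (complex.Re l - complex.Re (u x)).
  by case: (u x) l {hr hi hr1 hi1} => a b [c d] /=; rewrite opprB.
have -> : complex.Im (u x - l) = - (complex.Im l - complex.Im (u x)).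
  by case: (u x) l {hr hi hr1 hi1} => a b [c d] /=; rewrite opprB.
by rewrite !normrN; lra.
Qed.

End complex_modulus.

(** * Unconditional and absolute convergence over finite index sets *)

Section unconditional_sums.
Variables (R : realType) (I : choiceType).
Local Notation C := R[i].
Implicit Types (f g : I -> C) (l : C).

Definition has_sum f l := partial_sum (f : I -> C^o) @ totally --> (l : C^o).

(** Absolute convergence with an explicit constant, so that majorants can be rescaled and
    compared. *)
Definition abs_bounded f (M : R) :=
  forall J : {fset I}, \sum_(i <- J) normc (f i) <= M.

Lemma partial_sumE (V : zmodType) (f : I -> V) J :
  partial_sum f J = \sum_(i <- J) f i.
Proof. by rewrite /partial_sum big_seq_fsetE. Qed.

Lemma has_sumP f l : has_sum f l <->
  forall e : R, 0 < e -> exists J0 : {fset I}, forall J : {fset I},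
    (J0 `<=` J)%fset -> normc (\sum_(i <- J) f i - l) < e.
Proof.
rewrite /has_sum cvgCP; split => h e /h.
  case=> J0 _ hJ; exists J0 => J sJ; rewrite -partial_sumE; exact: hJ.
by case=> J0 hJ; exists J0 => // J sJ; rewrite /= partial_sumE; apply: hJ.
Qed.

Lemma has_sum_unique f l : has_sum f l ->
  summability.sum (f : I -> C^o) = l.
Proof. exact: (@cvg_lim C^o). Qed.

Lemma has_sum_cvg f l : has_sum f l ->
  cvg (partial_sum (f : I -> C^o) @ totally).
Proof. by move=> h; apply/cvg_ex; exists l. Qed.

Lemma has_sumD f g l m : has_sum f l -> has_sum g m ->
  has_sum (fun i => f i + g i) (l + m).
Proof.
move=> hf hg; rewrite /has_sum.
rewrite (_ : partial_sum _ = partial_sum (f : I -> C^o) \+ partial_sum (g : I -> C^o)).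
  exact: (@cvgD R[i] C^o _ _ _ _ _ _ _ hf hg).
by apply/funext => J /=; rewrite !partial_sumE big_split.
Qed.

Lemma has_sumMl f l (c : C) : has_sum f l -> has_sum (fun i => c * f i) (c * l).
Proof.
move=> hf; rewrite /has_sum.
rewrite (_ : partial_sum _ = fun J => c *: partial_sum (f : I -> C^o) J).
  exact: cvgZr.
by apply/funext => J /=; rewrite !partial_sumE scaler_sumr.
Qed.

Lemma has_sumMr f l (c : C) : has_sum f l -> has_sum (fun i => f i * c) (l * c).
Proof.
move=> /(@has_sumMl _ _ c); rewrite mulrC.
by congr has_sum; apply/funext => i; rewrite mulrC.
Qed.

Lemma has_sumB f g l m : has_sum f l -> has_sum g m ->
  has_sum (fun i => f i - g i) (l - m).
Proof.
move=> hf /(has_sumMl (c := -1)); rewrite mulN1r => /(has_sumD hf).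
by congr has_sum; apply/funext => i; rewrite mulN1r.
Qed.

Lemma has_sum_sum (T : Type) (r : seq T) (P : pred T) (f : T -> I -> C)
    (l : T -> C) : (forall k, P k -> has_sum (f k) (l k)) ->
  has_sum (fun i => \sum_(k <- r | P k) f k i) (\sum_(k <- r | P k) l k).
Proof.
move=> h; elim: r => [|k r IH].
  rewrite big_nil; apply/has_sumP => e e0; exists fset0 => J _.
  rewrite big1 ?subr0 ?Normc.normc0 // => i _; exact: big_nil.
rewrite big_cons (_ : (fun _ => _) = fun i =>
  if P k then f k i + \sum_(j <- r | P j) f j i else \sum_(j <- r | P j) f j i).
  by case Pk: (P k); [exact: (has_sumD (h k Pk) IH)|exact: IH].
by apply/funext => i; rewrite big_cons.
Qed.

Lemma has_sum_le f l (M : R) : has_sum f l -> abs_bounded f M -> normc l <= M.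
Proof.
move=> /has_sumP h hM; rewrite leNgt; apply/negP => lt_M.
have /h[J0 /(_ J0 (fsubset_refl _))] : 0 < normc l - M by rewrite subr_gt0.
apply/negP; rewrite -leNgt.
have := normcD (l - \sum_(i <- J0) f i) (\sum_(i <- J0) f i).
rewrite subrK normcB => h1.
have := le_trans (normc_sum _ xpredT f) (hM J0).
by lra.
Qed.

Lemma abs_bounded_le f g (M : R) : (forall i, normc (f i) <= normc (g i)) ->
  abs_bounded g M -> abs_bounded f M.
Proof. by move=> h hg J; apply: le_trans (hg J); apply: ler_sum => i _. Qed.

(* All finite sums of an unconditionally convergent series lie in a fixed
   disc; splitting a finite set according to the signs of the real and the
   imaginary parts turns this into a bound on the sums of moduli. *)
Lemma has_sum_abs_bounded f l : has_sum f l -> exists M, abs_bounded f M.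
Proof.
move=> /has_sumP /(_ 1 ltr01)[J0 hJ0].
(* The sum over [K] is the sum over the union of [J0] and [K], which is within 1 of [l], minus a sum
   over a part of [J0]. *)
pose M1 := 1 + normc l + \sum_(i <- J0) normc (f i).
have bnd (K : {fset I}) : normc (\sum_(i <- K) f i) <= M1.
  have -> : \sum_(i <- K) f i =
    (\sum_(i <- (J0 `|` K)%fset) f i - l) + l
    - \sum_(i <- [fset i in J0 | i \notin K]%fset) f i.
    rewrite subrK (big_fsetID _ (mem K) (J0 `|` K)%fset) /=.
    rewrite (_ : [fset x in (J0 `|` K)%fset | x \in K]%fset = K); last first.
      by apply/fsetP => i; rewrite !inE; case: (i \in K); rewrite ?orbT ?andbF.
    rewrite (_ : [fset x in (J0 `|` K)%fset | x \notin K]%fset =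
       [fset i in J0 | i \notin K]%fset) ?addrK //.
    by apply/fsetP => i; rewrite !inE; case: (i \in K); rewrite ?orbF ?andbF.
  apply: le_trans (normcD _ _) _; rewrite normcN.
  apply: lerD; last first.
    apply: le_trans (normc_sum _ _ _) _.
    rewrite (big_fsetID _ (fun i => i \in K) J0) /= lerDr.
    by apply: sumr_ge0 => i _; apply: normc_ge0.
  apply: le_trans (normcD _ _) _; rewrite lerD2r; apply/ltW/hJ0.
  exact: fsubsetUl.
have split_sign (F : I -> R) : (forall K : {fset I}, `|\sum_(i <- K) F i| <= M1) ->
    forall J : {fset I}, \sum_(i <- J) `|F i| <= M1 + M1.
  move=> hF J; rewrite (big_fsetID _ (fun i => 0 <= F i)) /=; apply: lerD.
    rewrite (@eq_big_seq _ _ _ _ _ _ F); last first.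
      by move=> i; rewrite !inE /= => /andP[_ /ger0_norm].
    exact: le_trans (ler_norm _) (hF _).
  rewrite (@eq_big_seq _ _ _ _ _ _ (fun i => - F i)); last first.
    by move=> i; rewrite !inE /= -ltNge => /andP[_ /ltr0_norm].
  by rewrite sumrN; apply: le_trans (ler_norm _) _; rewrite normrN.
(* One [M1] for each sign of the real part and of the imaginary part. *)
exists ((M1 + M1) + (M1 + M1)) => J.
apply: le_trans (ler_sum _ (fun i _ => normc_le_ReIm (f i))) _.
rewrite big_split /=; apply: lerD; apply: split_sign => K.
  rewrite -Re_sum; exact: le_trans (Re_le_normc _) (bnd K).
rewrite -Im_sum; exact: le_trans (Im_le_normc _) (bnd K).
Qed.

(** The limit is the supremum of the finite sums: beyond a nearly optimal [J0], monotonicity keeps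
    them close to it. *)
Lemma nneg_partial_sum_cvg (F : I -> R) (M : R) : (forall i, 0 <= F i) ->
  (forall J : {fset I}, \sum_(i <- J) F i <= M) ->
  exists s, (partial_sum F @ totally --> (s : R)).
Proof.
move=> F0 FM; pose A := range (partial_sum F).
have supA : has_sup A.
  split; first by exists (partial_sum F fset0), fset0.
  by exists M => _ [J _ <-]; rewrite partial_sumE.
exists (sup A); apply/cvgrPdist_lt => e e0.
have [_ [J0 _ <-] lt_J0] := sup_adherent e0 supA.
exists J0 => // J /= sJ; rewrite ger0_norm ?subr_ge0; last first.
  by apply: ub_le_sup; [exact: supA.2|exists J].
suff : partial_sum F J0 <= partial_sum F J by lra.
rewrite !partial_sumE (big_fsetID _ (mem J0) J) /=.
rewrite (_ : [fset x in J | x \in J0]%fset = J0).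
  by rewrite lerDl; apply: sumr_ge0.
by apply/fsetP => i; rewrite !inE andb_idl // => /(fsubsetP sJ).
Qed.

(** [F] is the difference of the nonnegative families [|F|] and [|F| - F], whose finite sums are
    bounded by [M] and [M + M]. *)
Lemma abs_bounded_real_cvg (F : I -> R) (M : R) :
  (forall J : {fset I}, \sum_(i <- J) `|F i| <= M) ->
  exists s, (partial_sum F @ totally --> (s : R)).
Proof.
move=> FM.
have [l1 h1] : exists s, (partial_sum (fun i => `|F i|) @ totally --> (s : R)).
  exact: nneg_partial_sum_cvg FM.
have [l2 h2] : exists s, (partial_sum (fun i => `|F i| - F i) @ totally --> (s : R)).
  apply: (@nneg_partial_sum_cvg _ (M + M)) => [i|J].
    by rewrite subr_ge0 ler_norm.
  rewrite big_split /= lerD //.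
  by apply: le_trans (ler_sum _ _) (FM J) => i _; rewrite -normrN ler_norm.
exists (l1 - l2).
rewrite (_ : partial_sum F = partial_sum (fun i => `|F i|) \-
  partial_sum (fun i => `|F i| - F i)); first exact: cvgB.
by apply/funext => J /=; rewrite !partial_sumE big_split /= sumrN opprB addrC subrK.
Qed.

(** With [has_sum_abs_bounded] this makes unconditional and absolute convergence interchangeable;
    here the real and imaginary parts are summed separately. *)
Lemma abs_bounded_has_sum f M : abs_bounded f M -> exists l, has_sum f l.
Proof.
move=> fM.
have [a ha] : exists s, (partial_sum (fun i => complex.Re (f i)) @ totally --> (s : R)).
  apply: (@abs_bounded_real_cvg _ M) => J; apply: le_trans (fM J).
  by apply: ler_sum => i _; apply: Re_le_normc.
have [b hb] : exists s, (partial_sum (fun i => complex.Im (f i)) @ totally --> (s : R)).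
  apply: (@abs_bounded_real_cvg _ M) => J; apply: le_trans (fM J).
  by apply: ler_sum => i _; apply: Im_le_normc.
exists (a +i* b); apply: cvg_complex.
  rewrite (_ : (fun J => _) = partial_sum (fun i => complex.Re (f i))) //.
  by apply/funext => J; rewrite !partial_sumE Re_sum.
rewrite (_ : (fun J => _) = partial_sum (fun i => complex.Im (f i))) //.
by apply/funext => J; rewrite !partial_sumE Im_sum.
Qed.

End unconditional_sums.

(** * Difference quotients and a second-order Taylor bound *)

Lemma norm_coord_le (K : realDomainType) n (v : 'rV[K]_n) l : `|v 0 l| <= `|v|.
Proof.
rewrite -[leRHS]/(mx_norm v) mx_normrE; apply/bigmax_geP; right => /=.
by exists (ord0, l).
Qed.

Section difference_quotients.
Context {K : numFieldType} {V W : normedModType K}.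
Implicit Types (f : V -> W) (x v : V).

Lemma differentiable_remainder f x (e : K) : differentiable f x -> 0 < e ->
  \forall h \near (0 : V), `|f (x + h) - f x - 'd f x h| <= e * `|h|.
Proof.
move=> df e0; have /diff_locally/eqaddoP/(_ _ e0) := df.
by apply: filterS => h; rewrite !fctE /= opprD addrA [h + x]addrC.
Qed.

(** A chain rule along an arbitrary filter: it serves two-sided real increments, one-sided ones in
    time, and complex scalars [h%:C] with [h] real. The differential of the quotient converges by
    continuity, and the remainder is small relative to [g i - x], which is of the order of [s i]. *)
Lemma diff_quotient_cvg {T : Type} {G : set_system T} {GG : Filter G}
    (s : T -> K) (g : T -> V) f x v :
  differentiable f x -> s @ G --> (0 : K) -> (\forall i \near G, s i != 0) ->
  (s i)^-1 *: (g i - x) @[i --> G] --> v ->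
  (s i)^-1 *: (f (g i) - f x) @[i --> G] --> 'd f x v.
Proof.
move=> df s0 sN0 gv.
have g0 : (g i - x) @[i --> G] --> (0 : V).
  rewrite -(scale0r v).
  apply: cvg_trans (cvgZ s0 gv); apply: near_eq_cvg.
  by apply: filterS sN0 => i si; rewrite scalerA divff // scale1r.
have dv : 'd f x ((s i)^-1 *: (g i - x)) @[i --> G] --> 'd f x v.
  have dc : {for v, continuous ('d f x)} by exact: diff_continuous.
  by have := continuous_cvg _ dc gv; apply.
have rem : (s i)^-1 *: (f (g i) - f x - 'd f x (g i - x)) @[i --> G] --> (0 : W).
  apply/cvgr0Pnorm_le => e e0.
  (* The quotient tends to [v], so its norm is eventually at most [|v| + 1]. *)
  have b0 : 0 < `|v| + 1 by rewrite ltr_wpDl.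
  have eb0 : 0 < e / (`|v| + 1) by rewrite divr_gt0.
  have := g0 _ (differentiable_remainder df eb0).
  have /cvgrPdist_le/(_ 1 ltr01) := gv.
  apply: filterS3 sN0 => i si hb; rewrite /= [x + _]addrC subrK => hr.
  rewrite normrZ normfV ler_pdivrMl ?normr_gt0 //.
  have hg : `|g i - x| <= `|s i| * (`|v| + 1).
    rewrite -ler_pdivrMl ?normr_gt0 // -normfV -normrZ.
    rewrite -[X in `|X|](subrK v) addrC; apply: le_trans (ler_normD _ _) _.
    by rewrite lerD2l distrC.
  apply: le_trans hr _; apply: le_trans (ler_wpM2l (ltW eb0) hg) _.
  by rewrite mulrCA divfK // gt_eqF.
rewrite -['d f x v]addr0 (_ : (fun i => _) = (fun i => 'd f x ((s i)^-1 *: (g i - x)))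
  \+ (fun i => (s i)^-1 *: (f (g i) - f x - 'd f x (g i - x)))); first exact: cvgD.
apply/funext => i /=.
by rewrite linearZ /= -scalerDr; congr (_ *: _); rewrite [RHS]addrC subrK.
Qed.

End difference_quotients.

(** * Real functions along segments *)

Section partial_derivatives.
Variables (R : realType) (n : nat).
Local Notation state := 'rV[R]_n.
Implicit Types (u : state -> R) (x v : state).

Lemma diff_sum_partial u x v : differentiable u x ->
  'd u x v = \sum_(l < n) 'D_(delta_mx 0 l) u x * v 0 l.
Proof.
move=> du; rewrite [in LHS](row_sum_delta v) linear_sum; apply: eq_bigr => l _.
by rewrite linearZ /= deriveE // mulrC.
Qed.

Lemma differentiable_lipschitz_at u x : differentiable u x ->
  exists k : R, 0 <= k /\ \forall h \near (0 : state), `|u (x + h) - u x| <= k * `|h|.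
Proof.
move=> du; have [k k0 hk] := linear_lipschitz (diff_continuous du).
exists (k + 1); split; first by rewrite addr_ge0 // ltW.
apply: filterS (differentiable_remainder du ltr01) => h hr.
rewrite -[X in `|X|](subrK ('d u x h)); apply: le_trans (ler_normD _ _) _.
by rewrite mulrDl addrC lerD.
Qed.

Lemma is_derive_line u x v (s : R) : differentiable u (x + s *: v) ->
  is_derive s 1 (fun s => u (x + s *: v))
    (\sum_(l < n) 'D_(delta_mx 0 l) u (x + s *: v) * v 0 l).
Proof.
move=> du.
have h : h^-1 *: (((fun s => u (x + s *: v)) \o shift s) (h *: 1) - u (x + s *: v))
    @[h --> 0^'] --> \sum_(l < n) 'D_(delta_mx 0 l) u (x + s *: v) * v 0 l.
  rewrite -diff_sum_partial //.
  apply: (@diff_quotient_cvg _ _ _ _ (0^') _ id (fun h => x + (h *: 1 + s) *: v)).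
  - exact: du.
  - exact: cvg_within.
  - exact: nbhs_dnbhs_neq.
  - apply: cvg_near_cst; near=> h.
    rewrite scalerDl opprD addrACA subrr add0r addrK scalerA [h *: 1]mulr1 mulVf ?scale1r //.
    by near: h; exact: nbhs_dnbhs_neq.
apply: DeriveDef; first by apply/cvg_ex; eexists; exact: h.
exact: (@cvg_lim R).
Unshelve. all: by end_near. Qed.

(** The mean value theorem on the segment from [x] to [x + h] leaves increments of the first partial
    derivatives, which are of order [|h|] by their differentiability at [x]; a factor [h 0 l]
    supplies the second order. *)
Lemma taylor2_bound (B : set state) u x : open B -> B x ->
  (forall y, B y -> differentiable u y) ->
  (forall l : 'I_n, differentiable (fun y => 'D_(delta_mx 0 l) u y) x) ->
  exists M : R, 0 <= M /\ \forall h \near (0 : state),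
    `|u (x + h) - u x - \sum_(l < n) 'D_(delta_mx 0 l) u x * h 0 l|
      <= M * `|h| ^+ 2.
Proof.
move=> oB Bx du d2u.
have /choice[k hk] := fun l => differentiable_lipschitz_at (d2u l).
exists (\sum_l k l); split; first by apply: sumr_ge0 => l _; have [] := hk l.
have : \forall h \near (0 : state), forall l : 'I_n,
    `|'D_(delta_mx 0 l) u (x + h) - 'D_(delta_mx 0 l) u x| <= k l * `|h|.
  exact: (@filter_forall _ _ _ _ _ (fun l => (hk l).2)).
have : \forall h \near (0 : state), B (x + h).
  by apply/(nbhs0P B x); exact: open_nbhs_nbhs.
move=> /nbhs_ballP[e1 /= e10 h1] /nbhs_ballP[e2 /= e20 h2].
(* The first radius keeps the whole segment in [B], the second makes the bounds on the partial
   derivatives valid at each of its points. *)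
apply/nbhs_ballP; exists (Num.min e1 e2) => /=; first by rewrite lt_min e10.
move=> h; rewrite -ball_normE /ball_ /= sub0r normrN lt_min => /andP[he1 he2].
have seg (s : R) : s \in `[0, 1] -> `|s *: h| <= `|h|.
  rewrite in_itv /= => /andP[s0 s1]; rewrite normrZ ger0_norm //.
  by rewrite ler_piMl.
have Bseg s : s \in `[0, 1] -> B (x + s *: h).
  move=> /seg sh; apply: h1; rewrite -ball_normE /ball_ /= sub0r normrN.
  exact: le_lt_trans he1.
have [|s s01||s c01] := @MVT_segment R (fun s => u (x + s *: h))
  (fun s => \sum_(l < n) 'D_(delta_mx 0 l) u (x + s *: h) * h 0 l) 0 1.
- exact: ler01.
- by apply/is_derive_line/du/Bseg/subset_itv_oo_cc.
- apply: derivable_within_continuous => s /Bseg/du ds.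
  by have [] := is_derive_line ds.
rewrite scale1r scale0r addr0 subr0 mulr1 => ->.
rewrite -sumrB mulr_suml; apply: le_trans (ler_norm_sum _ _ _) _.
apply: ler_sum => l _; rewrite -mulrBl normrM expr2 mulrA.
apply: ler_pM => //; last exact: norm_coord_le.
have [k0 _] := hk l.
apply: le_trans (ler_wpM2l k0 (seg _ c01)); apply: h2.
rewrite -ball_normE /ball_ /= sub0r normrN; apply: le_lt_trans he2; exact: seg.
Qed.

End partial_derivatives.

(** * First-order jets of complex observables *)

Section jets.
Variables (R : realType) (n : nat).
Local Notation C := R[i].
Local Notation state := 'rV[R]_n.
Implicit Types (f g : state -> C) (x h : state) (l : 'I_n).

Definition cdifferentiable f x :=
  differentiable (fun y => complex.Re (f y)) x /\
  differentiable (fun y => complex.Im (f y)) x.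

Definition cdifferential f x h := \sum_(l < n) pderiv l f x * (h 0 l)%:C.

Lemma cdifferentiableM f g x : cdifferentiable f x -> cdifferentiable g x ->
  cdifferentiable (fun y => f y * g y) x.
Proof.
move=> [f1 f2] [g1 g2]; split.
  rewrite (_ : (fun _ => _) = (fun y => complex.Re (f y)) * (fun y => complex.Re (g y))
    - (fun y => complex.Im (f y)) * (fun y => complex.Im (g y))).
    by apply: differentiableB; apply: differentiableM.
  by apply/funext => y; rewrite !fctE; case: (f y) (g y) => ? ? [].
rewrite (_ : (fun _ => _) = (fun y => complex.Re (f y)) * (fun y => complex.Im (g y))
  + (fun y => complex.Im (f y)) * (fun y => complex.Re (g y))).
  by apply: differentiableD; apply: differentiableM.
by apply/funext => y; rewrite !fctE; case: (f y) (g y) => ? ? [].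
Qed.

Lemma pderivM f g x l : cdifferentiable f x -> cdifferentiable g x ->
  pderiv l (fun y => f y * g y) x = f x * pderiv l g x + pderiv l f x * g x.
Proof.
move=> [f1 f2] [g1 g2]; rewrite /pderiv.
rewrite (_ : (fun y => complex.Re (f y * g y)) =
    (fun y => complex.Re (f y)) * (fun y => complex.Re (g y))
    - (fun y => complex.Im (f y)) * (fun y => complex.Im (g y))); last first.
  by apply/funext => y; rewrite !fctE; case: (f y) (g y) => ? ? [].
rewrite (_ : (fun y => complex.Im (f y * g y)) =
    (fun y => complex.Re (f y)) * (fun y => complex.Im (g y))
    + (fun y => complex.Im (f y)) * (fun y => complex.Re (g y))); last first.
  by apply/funext => y; rewrite !fctE; case: (f y) (g y) => ? ? [].
rewrite deriveB; do ?by apply: derivableM; apply: diff_derivable.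
rewrite deriveD; do ?by apply: derivableM; apply: diff_derivable.
rewrite !deriveM; do ?by apply: diff_derivable.
move: ('D_(delta_mx 0 l) (fun y => complex.Re (f y)) x : R)
  ('D_(delta_mx 0 l) (fun y => complex.Im (f y)) x : R)
  ('D_(delta_mx 0 l) (fun y => complex.Re (g y)) x : R)
  ('D_(delta_mx 0 l) (fun y => complex.Im (g y)) x : R) => a b c d.
case: (f x) (g x) => fr fi [gr gi].
apply/eqP; rewrite eq_complex; apply/andP; rewrite /GRing.scale /=.
by split; apply/eqP; ring.
Qed.

Lemma cdifferentialM f g x h : cdifferentiable f x -> cdifferentiable g x ->
  cdifferential (fun y => f y * g y) x h =
  f x * cdifferential g x h + cdifferential f x h * g x.
Proof.
move=> df dg; rewrite /cdifferential mulr_sumr mulr_suml -big_split /=.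
by apply: eq_bigr => l _; rewrite pderivM //; ring.
Qed.

Lemma cdifferentialZ f x (s : R) h :
  cdifferential f x (s *: h) = s%:C * cdifferential f x h.
Proof.
rewrite /cdifferential mulr_sumr; apply: eq_bigr => l _.
by rewrite mxE rmorphM /=; ring.
Qed.

Lemma cdifferential_delta f x l : cdifferential f x (delta_mx 0 l) = pderiv l f x.
Proof.
rewrite /cdifferential (bigD1 l) //= mxE !eqxx mulr1 big1 ?addr0 // => i il.
by rewrite mxE eqxx (negbTE il) mulr0.
Qed.

(* With [d = r - b] and [s = |h| / eta], the bounds are [b] on the value, [s d]
   on the differential and on the increment, and [s ^ 2 d] on the remainder.
   This format is stable under products, with [b] and [r] multiplicative, so
   that no estimate depending on the exponents is needed for the monomials in
   the eigenfunctions. *)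
Definition jet x (eta b r : R) f := [/\ cdifferentiable f x, 0 <= b <= r,
  normc (f x) <= b & forall h, `|h| <= eta ->
  [/\ normc (cdifferential f x h) <= `|h| / eta * (r - b),
      normc (f (x + h) - f x) <= `|h| / eta * (r - b) &
      normc (f (x + h) - f x - cdifferential f x h)
        <= (`|h| / eta) ^+ 2 * (r - b)]].

Lemma jet1 x eta : jet x eta 1 1 (fun=> 1).
Proof.
have c0 h : cdifferential (fun=> 1) x h = 0.
  by rewrite /cdifferential big1 // => l _; rewrite /pderiv !derive_cst mul0r.
split; [split; exact: differentiable_cst| |by rewrite Normc.normc1|].
  by rewrite ler01 lexx.
by move=> h _; rewrite c0 !subrr !Normc.normc0 !mulr0.
Qed.

(** With [d = r - b] and [d' = r' - b'], [r r' - b b' = b d' + d b' + d d'], matching the three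
    terms of the increment of a product. In the remainder the bounds add up exactly; in the
    increment [s <= 1] absorbs [s ^ 2 d d']; the differential has only the first two terms. *)
Lemma jetM x eta b r f b' r' f' : 0 < eta -> jet x eta b r f ->
  jet x eta b' r' f' -> jet x eta (b * b') (r * r') (fun y => f y * f' y).
Proof.
move=> eta0 [df /andP[b0 br] fb hf] [df' /andP[b'0 br'] fb' hf'].
split; first exact: cdifferentiableM.
- by rewrite mulr_ge0 //= ler_pM.
- by rewrite Normc.normcM ler_pM // normc_ge0.
move=> h hh; rewrite cdifferentialM //.
have [L D Q] := hf h hh; have [L' D' Q'] := hf' h hh.
set s := `|h| / eta in L D Q L' D' Q' *.
have s0 : 0 <= s by rewrite divr_ge0 // ltW.
have s1 : s <= 1 by rewrite ler_pdivrMr // mul1r.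
have d0 : 0 <= r - b by rewrite subr_ge0.
have d'0 : 0 <= r' - b' by rewrite subr_ge0.
have -> : r * r' - b * b' = b * (r' - b') + (r - b) * b' + (r - b) * (r' - b').
  by ring.
set d := r - b in L D Q d0 *; set d' := r' - b' in L' D' Q' d'0 *.
clearbody s d d'.
have M3 (u v w u' v' w' : R) (z1 z2 z3 z1' z2' z3' : C) :
    normc z1 <= u -> normc z1' <= u' -> normc z2 <= v -> normc z2' <= v' -> normc z3 <= w -> normc z3' <= w' ->
    normc (z1 * z1' + z2 * z2' + z3 * z3') <= u * u' + v * v' + w * w'.
  move=> ? ? ? ? ? ?; apply: le_trans (normcD _ _) _; apply: lerD.
    apply: le_trans (normcD _ _) _.
    by apply: lerD; rewrite Normc.normcM ler_pM // normc_ge0.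
  by rewrite Normc.normcM ler_pM // normc_ge0.
have ss : s * s <= s by rewrite ler_piMl.
have dd' : 0 <= d * d' by rewrite mulr_ge0.
have ssdd' : s * s * (d * d') <= s * (d * d') by rewrite ler_wpM2r.
split.
- have := M3 b (s * d) 0 (s * d') b' 0 _ _ 0 _ _ 0 fb L' L fb'.
  rewrite mulr0 addr0 Normc.normc0 => /(_ (lexx _) (lexx _)) /le_trans; apply.
  rewrite -subr_ge0 (_ : _ - _ = s * (d * d')); last by ring.
  exact: mulr_ge0.
- have -> : f (x + h) * f' (x + h) - f x * f' x =
    f x * (f' (x + h) - f' x) + (f (x + h) - f x) * f' x
    + (f (x + h) - f x) * (f' (x + h) - f' x) by ring.
  apply: le_trans (M3 _ _ _ _ _ _ _ _ _ _ _ _ fb D' D fb' D D') _.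
  rewrite -subr_ge0 (_ : _ - _ = s * (d * d') - s * s * (d * d')); last by ring.
  by rewrite subr_ge0.
- have -> : f (x + h) * f' (x + h) - f x * f' x -
      (f x * cdifferential f' x h + cdifferential f x h * f' x) =
    f x * (f' (x + h) - f' x - cdifferential f' x h)
    + (f (x + h) - f x - cdifferential f x h) * f' x
    + (f (x + h) - f x) * (f' (x + h) - f' x) by ring.
  apply: le_trans (M3 _ _ _ _ _ _ _ _ _ _ _ _ fb Q' Q fb' D D') _.
  by rewrite le_eqVlt; apply/orP; left; apply/eqP; ring.
Qed.

Lemma jet_prod (I : Type) (q : seq I) x eta (b r : I -> R) (f : I -> state -> C) :
  0 < eta -> (forall i, jet x eta (b i) (r i) (f i)) ->
  jet x eta (\prod_(i <- q) b i) (\prod_(i <- q) r i)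
    (fun y => \prod_(i <- q) f i y).
Proof.
move=> eta0 hf; elim: q => [|i q IH].
  rewrite !big_nil (_ : (fun _ => _) = fun=> 1); first exact: jet1.
  by apply/funext => y; rewrite big_nil.
rewrite !big_cons (_ : (fun _ => _) = fun y => f i y * \prod_(j <- q) f j y).
  exact: jetM.
by apply/funext => y; rewrite big_cons.
Qed.

Lemma jetX x eta b r f k : 0 < eta -> jet x eta b r f ->
  jet x eta (b ^+ k) (r ^+ k) (fun y => f y ^+ k).
Proof.
move=> eta0 hf; elim: k => [|k IH]; first exact: jet1.
rewrite !exprS (_ : (fun _ => _) = fun y => f y * f y ^+ k); first exact: jetM.
by apply/funext => y; rewrite exprS.
Qed.

Lemma norm_delta_le1 l : `|delta_mx 0 l : state| <= 1.
Proof.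
rewrite -[leLHS]/(mx_norm _) mx_normrE; apply/bigmax_leP; split => //= -[i j] _ /=.
by rewrite mxE; case: (_ && _); rewrite ?normr1 ?normr0.
Qed.

(** The bound on the differential is applied to the vector [eta *: delta_mx 0 l], whose norm is at
    most [eta], and [r - b] is at most [r]. *)
Lemma jet_pderiv_le x eta b r f l : 0 < eta -> jet x eta b r f ->
  normc (pderiv l f x) <= eta^-1 * r.
Proof.
move=> eta0 [_ /andP[b0 br] _ /(_ (eta *: delta_mx 0 l)) h].
have hn : `|eta *: (delta_mx 0 l : state)| <= eta.
  by rewrite normrZ gtr0_norm // ler_piMr ?norm_delta_le1 // ltW.
have [+ _ _] := h hn.
rewrite cdifferentialZ cdifferential_delta Normc.normcM normcR gtr0_norm //.
rewrite -ler_pdivlMl // => /le_trans; apply.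
rewrite ler_pM2l ?invr_gt0 //.
have : `|eta *: (delta_mx 0 l : state)| / eta <= 1 by rewrite ler_pdivrMr // mul1r.
have d0 : 0 <= r - b by rewrite subr_ge0.
by move=> /(ler_wpM2r d0); rewrite mul1r => /le_trans; apply; rewrite gerBl.
Qed.

Lemma smooth_cdifferentiable (B : set state) f x : smooth_on B f -> B x ->
  cdifferentiable f x.
Proof. by move=> /(_ 1) [[h1 _] [h2 _]] Bx; split; [apply: h1|apply: h2]. Qed.

Lemma smooth_taylor2 (B : set state) f x : open B -> B x -> smooth_on B f ->
  exists M : R, 0 <= M /\ \forall h \near (0 : state),
    normc (f (x + h) - f x - cdifferential f x h) <= M * `|h| ^+ 2.
Proof.
move=> oB Bx /(_ 2)[[du1 du2] [dv1 dv2]].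
have [M1 [M10 h1]] := taylor2_bound oB Bx du1 (fun l => (du2 l).1 x Bx).
have [M2 [M20 h2]] := taylor2_bound oB Bx dv1 (fun l => (dv2 l).1 x Bx).
exists (M1 + M2); split; first exact: addr_ge0.
apply: filterS2 h1 h2 => h h1 h2; rewrite mulrDl.
apply: le_trans (normc_le_ReIm _) (lerD _ _).
  apply: le_trans h1; rewrite le_eqVlt; apply/orP; left; apply/eqP; congr `|_|.
  rewrite !raddfB /= Re_sum; congr (_ - _); apply: eq_bigr => l _.
  by rewrite /= mulr0 subr0.
apply: le_trans h2; rewrite le_eqVlt; apply/orP; left; apply/eqP; congr `|_|.
rewrite !raddfB /= Im_sum; congr (_ - _); apply: eq_bigr => l _.
by rewrite /= mulr0 add0r.
Qed.

(** The slack [d] is given first and [eta] is shrunk to fit it. For [|h| = eta s] the differential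
    is at most [s eta K] and, as [eta < 1], the remainder at most [s ^ 2 eta M]; hence
    [eta (M + K + 1) < d] suffices, the 1 keeping the divisor positive. *)
Lemma smooth_jet (B : set state) f x (d : R) : open B -> B x -> smooth_on B f ->
  0 < d -> \forall eta \near (0 : R)^'+,
    jet x eta (normc (f x)) (normc (f x) + d) f.
Proof.
move=> oB Bx sf d0; have [M [M0 /nbhs_ballP[e /= e0 hM]]] := smooth_taylor2 oB Bx sf.
pose K := \sum_(l < n) normc (pderiv l f x).
have K0 : 0 <= K by apply: sumr_ge0 => l _; exact: normc_ge0.
have hK h : normc (cdifferential f x h) <= K * `|h|.
  rewrite mulr_suml; apply: le_trans (normc_sum _ _ _) (ler_sum _ _) => l _.
  by rewrite Normc.normcM normcR ler_wpM2l ?normc_ge0 ?norm_coord_le.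
have MK : 0 < M + K + 1 by lra.
near=> eta.
have eta0 : 0 < eta by [].
have eta1 : eta < 1 by near: eta; exact: nbhs_right_lt.
have etae : eta < e by near: eta; exact: nbhs_right_lt.
have etad : eta < d / (M + K + 1).
  by near: eta; apply: nbhs_right_lt; rewrite divr_gt0.
rewrite ltr_pdivlMr // in etad.
split; first exact: smooth_cdifferentiable sf Bx.
- by rewrite normc_ge0 lerDl ltW.
- by [].
move=> h heta; rewrite addrC addKr.
have hb : normc (f (x + h) - f x - cdifferential f x h) <= M * `|h| ^+ 2.
  by apply: hM; rewrite -ball_normE /= sub0r normrN; apply: le_lt_trans etae.
have hE : `|h| = eta * (`|h| / eta) by rewrite mulrCA mulfV ?mulr1 // gt_eqF.
have s0 : 0 <= `|h| / eta by rewrite divr_ge0 // ltW.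
have s1 : `|h| / eta <= 1 by rewrite ler_pdivrMr // mul1r.
have hK1 := hK h; set s := `|h| / eta in hE s0 s1 *.
clearbody s; rewrite hE in hb hK1.
rewrite (_ : K * _ = s * (eta * K)) in hK1; last by ring.
have ss : s ^+ 2 <= s by rewrite expr2 ler_piMl.
have etaM : eta * M <= d by nra.
have etaK : eta * K <= d by nra.
have etaMK : eta * (M + K) <= d by nra.
have hM' : M * (eta * s) ^+ 2 <= s ^+ 2 * (eta * M).
  rewrite exprMn (_ : M * _ = s ^+ 2 * (eta * M) * eta); last by ring.
  apply: ler_piMr (ltW eta1); apply: mulr_ge0; first exact: exprn_ge0.
  by rewrite mulr_ge0 // ltW.
split.
- by apply: le_trans hK1 _; rewrite ler_wpM2l.
- rewrite -[X in normc X](subrK (cdifferential f x h)).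
  apply: le_trans (normcD _ _) (le_trans (lerD hb hK1) _).
  apply: (@le_trans _ _ (s * (eta * (M + K)))); last by rewrite ler_wpM2l.
  rewrite mulrDr mulrDr lerD2r; apply: le_trans hM' _.
  by rewrite ler_wpM2r // mulr_ge0 // ltW.
- by apply: le_trans hb (le_trans hM' _); rewrite ler_wpM2l // exprn_ge0.
Unshelve. all: by end_near. Qed.

End jets.

(** * Gradients of the eigenfunctions *)

Section complex_exponential.
Variable R : realType.
Local Notation C := R[i].
Implicit Types (z : C).

Lemma normc_cexp z : normc (cexp z) = expR (complex.Re z).
Proof.
rewrite /cexp /= !exprMn -mulrDr addrC -[sin _ ^+ 2 + _]addrC cos2Dsin2 mulr1.
by rewrite sqrtr_sqr ger0_norm // expR_ge0.
Qed.

Lemma cexp0 : cexp (0 : C) = 1.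
Proof. by rewrite /cexp /= expR0 cos0 sin0 mulr1 mulr0. Qed.

Lemma normc_cexp_le1 z (t : R) : 0 <= t -> complex.Re z <= 0 ->
  normc (cexp (z * t%:C)) <= 1.
Proof.
move=> t0 z0; rewrite normc_cexp -expR0 ler_expR; case: z z0 => a b /= a0.
by rewrite mulr0 subr0 mulr_le0_ge0.
Qed.

Lemma Re_cexp_derive z w :
  is_derive (0 : R) 1 (fun h => complex.Re (cexp (z * h%:C) * w))
    (complex.Re (z * w)).
Proof.
case: z w => a b [p q] /=.
rewrite (_ : (fun h => _) = fun h : R => expR (a * h) * cos (b * h) * p
    - expR (a * h) * sin (b * h) * q); last first.
  by apply/funext => h; rewrite !mulr0 subr0 add0r.
apply: is_derive_eq.
by rewrite !mulr0 expR0 cos0 sin0 /GRing.scale /=; ring.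
Qed.

Lemma Im_cexp_derive z w :
  is_derive (0 : R) 1 (fun h => complex.Im (cexp (z * h%:C) * w))
    (complex.Im (z * w)).
Proof.
case: z w => a b [p q] /=.
rewrite (_ : (fun h => _) = fun h : R => expR (a * h) * cos (b * h) * q
    + expR (a * h) * sin (b * h) * p); last first.
  by apply/funext => h; rewrite !mulr0 subr0 add0r.
apply: is_derive_eq.
by rewrite !mulr0 expR0 cos0 sin0 /GRing.scale /=; ring.
Qed.

End complex_exponential.

Lemma ex_right_pos (R : realType) (P : R -> Prop) :
  (\forall e \near (0 : R)^'+, P e) -> exists2 e, 0 < e & P e.
Proof.
move=> h; have : \forall e \near (0 : R)^'+, 0 < e /\ P e.
  by near=> e; split=> //; near: e.
by move=> /filter_ex[e [e0 he]]; exists e.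
Unshelve. all: by end_near. Qed.

(** * Derivatives along the vector field and along generic directions *)

Section directional.
Variables (R : realType) (n : nat).
Local Notation C := R[i].
Local Notation state := 'rV[R]_n.

(** The right derivative of [f] along the solution at time 0 is computed twice, by the chain rule
    and through [G]. It is one-sided because [f (u t) = G t] is given for nonnegative times. *)
Lemma solution_derive (F : state -> state) x (u : R -> state) (f : state -> R)
    (G : R -> R) (d : R) : solution F x u -> differentiable f x ->
  (forall t, 0 <= t -> f (u t) = G t) -> is_derive (0 : R) (1 : R) G d ->
  'd f x (F x) = d.
Proof.
move=> [u0 du] df fG dG.
have inc : ((0 : R)^'+ : set_system R) --> within [set h : R | 0 <= 0 + h] (0 : R)^'.
  move=> P hP.
  have {}hP : \forall h \near (0 : R), h != 0 -> 0 <= 0 + h -> P h by exact: hP.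
  suff : \forall h \near (0 : R), 0 < h -> P h by [].
  by apply: filterS hP => h hP h0; apply: hP; rewrite ?gt_eqF // add0r ltW.
have inc' : ((0 : R)^'+ : set_system R) --> (0 : R)^'.
  move=> P hP; have {}hP : \forall h \near (0 : R), h != 0 -> P h by exact: hP.
  suff : \forall h \near (0 : R), 0 < h -> P h by [].
  by apply: filterS hP => h hP h0; apply: hP; rewrite gt_eqF.
have r0 : (h^-1 *: (u h - x)) @[h --> 0^'+] --> F x.
  have := du 0 (lexx _); rewrite u0.
  rewrite (_ : (fun h => _) = fun h => h^-1 *: (u h - x)); last first.
    by apply/funext => h; rewrite add0r.
  exact: (cvg_trans (cvg_app _ inc)).
have l1 : (h^-1 *: (f (u h) - f x)) @[h --> 0^'+] --> 'd f x (F x).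
  apply: diff_quotient_cvg r0 => //; first exact: cvg_within.
  by near=> h; rewrite gt_eqF.
have l2 : (h^-1 *: (f (u h) - f x)) @[h --> 0^'+] --> d.
  have [Gd <-] := dG.
  have : h^-1 *: (G h - G 0) @[h --> 0^'+] --> 'D_1 G 0.
    rewrite (_ : (fun h => _) = fun h : R => h^-1 *: ((G \o shift 0) (h *: 1) - G 0)).
      exact: (cvg_trans (cvg_app _ inc') Gd).
    by apply/funext => h /=; rewrite addr0 [h *: 1]mulr1.
  apply: cvg_trans; apply: near_eq_cvg; near=> h.
  have h0 : 0 <= h by rewrite ltW.
  by rewrite -(fG h h0) -(fG 0 (lexx 0)) u0.
exact: cvg_unique l1 l2.
Unshelve. all: by end_near. Qed.

(** The infinitesimal form of the eigenvalue relation, obtained by differentiating it in time at 0,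
    separately for real and imaginary parts. *)
Lemma eigenfunction_cdifferential (F : state -> state) (S : R -> state -> state)
    (B : set state) (mu : C) (f : state -> C) x :
  flow F S -> koopman_eigenfunction S B mu f -> B x -> cdifferentiable f x ->
  cdifferential f x (F x) = mu * f x.
Proof.
move=> /(_ x)[sol _] [_ eig] Bx [dr di].
have er : 'd (fun y => complex.Re (f y)) x (F x) = complex.Re (mu * f x).
  apply: solution_derive sol dr _ (Re_cexp_derive _ _) => t t0.
  by have := eig t x t0 Bx; rewrite /koopman /= => ->.
have ei : 'd (fun y => complex.Im (f y)) x (F x) = complex.Im (mu * f x).
  apply: solution_derive sol di _ (Im_cexp_derive _ _) => t t0.
  by have := eig t x t0 Bx; rewrite /koopman /= => ->.
rewrite diff_sum_partial // in er; rewrite diff_sum_partial // in ei.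
apply/eqP; rewrite eq_complex -er -ei /cdifferential Re_sum Im_sum.
apply/andP; split; apply/eqP; apply: eq_bigr => l _ /=.
  by rewrite mulr0 subr0.
by rewrite mulr0 add0r.
Qed.

(* Along the moment curve [c |-> (1, c, c ^ 2, ...)] each of the finitely many
   nonzero functionals is a nonzero polynomial in [c]. *)
Lemma generic_direction (I : finType) (A : I -> 'I_n -> C) :
  (forall i, exists l, A i l != 0) ->
  exists w : state, forall i, \sum_(l < n) A i l * (w 0 l)%:C != 0.
Proof.
move=> A0; pose p i := \sum_(l < n) A i l *: 'X^l.
have pc i (l : 'I_n) : (p i)`_l = A i l.
  rewrite coef_sum (bigD1 l) //= coefZ coefXn eqxx mulr1 big1 ?addr0 // => k kl.
  by rewrite coefZ coefXn eq_sym (inj_eq val_inj) (negbTE kl) mulr0.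
have p0 i : p i != 0.
  have [l Al] := A0 i; apply: contraNneq Al => pi0.
  by rewrite -pc pi0 coef0.
pose P := \prod_i p i.
have P0 : P != 0 by apply/prodf_neq0 => i _; exact: p0.
(* A nonzero [P] has fewer than [size P] roots, so one of these points is not a root. Natural
   numbers are taken so that the resulting direction [w] is real. *)
pose s := [seq (k%:R : C) | k <- iota 0 (size P)].
have us : uniq s.
  by rewrite map_inj_uniq ?iota_uniq //; apply: mulrIn; exact: oner_neq0.
have /allPn[c cs Pc] : ~~ all (root P) s.
  apply/negP => rs; have := max_poly_roots P0 rs us.
  by rewrite size_map size_iota ltnn.
have /mapP[k _ ck] := cs.
exists (\row_l k%:R ^+ l) => i.
have : ~~ root (p i) c.
  by apply: contra Pc => pc0; rewrite /P (bigD1 i) //= rootM pc0.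
rewrite /root horner_sum; apply: contra => /eqP pc0.
rewrite -[X in _ == X]pc0; apply/eqP; apply: eq_bigr => l _.
by rewrite hornerZ hornerXn mxE ck rmorphXn /= rmorph_nat.
Qed.

Lemma matrix_cvg {K : numFieldType} {T : Type} {G : set_system T} {GG : Filter G}
    (p q : nat) (u : T -> 'M[K]_(p, q)) (a : 'M[K]_(p, q)) :
  (forall i j, u t i j @[t --> G] --> a i j) -> u @ G --> a.
Proof.
move=> h; apply/cvg_ballP => e e0.
have : \forall t \near G, forall i j, ball (a i j) e (u t i j).
  by apply: filter_forall => i; apply: filter_forall => j; exact: cvg_ball.
by apply: filterS => t ht; split.
Qed.

Lemma real_complex_cvg0 : (h%:C : C^o) @[h --> (0 : R)^'] --> (0 : C^o).
Proof.
apply/cvgCP => e e0.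
have : (h : R) @[h --> (0 : R)^'] --> (0 : R) by exact: cvg_within.
move=> /cvgrPdist_lt/(_ _ e0); apply: filterS => h.
by rewrite sub0r normrN subr0 normcR.
Qed.

Section left_inverse.
Variables (B : set state) (phi : 'I_n -> state -> C).
Hypotheses (openB : open B) (smooth_phi : forall j, smooth_on B (phi j)).

Lemma near_line (x v : state) : B x -> \forall h \near (0 : R)^', B (x + h *: v).
Proof.
move=> Bx; have c : x + h *: v @[h --> (0 : R)^'] --> x.
  rewrite -[X in _ --> X]addr0 -(scale0r v).
  by apply: cvgD; [exact: cvg_cst|apply: cvgZr_tmp; exact: cvg_within].
exact: (c _ (open_nbhs_nbhs (conj openB Bx))).
Qed.

(** The increments are real, but the quotient is formed over [C], so that the complex chain rule for
    an entire function composed with [hmap phi] can take this limit. *)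
Lemma hmap_partial_cvg (x : state) (l : 'I_n) : B x ->
  (h%:C : C)^-1 *: (hmap phi (x + h *: delta_mx 0 l) - hmap phi x)
    @[h --> (0 : R)^'] --> \row_j pderiv l (phi j) x.
Proof.
move=> Bx; apply: matrix_cvg => i j.
have [dr di] := smooth_cdifferentiable (smooth_phi j) Bx.
have dq (f : state -> R) : differentiable f x ->
    h^-1 *: (f (x + h *: delta_mx 0 l) - f x) @[h --> 0^'] --> 'D_(delta_mx 0 l) f x.
  move=> df; rewrite deriveE //.
  apply: (@diff_quotient_cvg _ _ _ _ (0^') _ id (fun h => x + h *: delta_mx 0 l)) => //.
  - exact: cvg_within.
  - exact: nbhs_dnbhs_neq.
  - apply: cvg_near_cst; near=> h.
    rewrite addrC addKr scalerA mulVf ?scale1r //.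
    by near: h; exact: nbhs_dnbhs_neq.
rewrite mxE.
rewrite (_ : (fun _ => _) = fun h : R =>
    (h^-1)%:C * (phi j (x + h *: delta_mx 0 l) - phi j x)).
  apply: cvg_complex => /=.
    rewrite (_ : (fun _ => _) = fun h : R => h^-1 *:
      (complex.Re (phi j (x + h *: delta_mx 0 l)) - complex.Re (phi j x))).
      exact: dq.
    apply/funext => h; case: (phi j _) => a b; case: (phi j x) => c d /=.
    by rewrite mul0r subr0.
  rewrite (_ : (fun _ => _) = fun h : R => h^-1 *:
    (complex.Im (phi j (x + h *: delta_mx 0 l)) - complex.Im (phi j x))).
    exact: dq.
  apply/funext => h; case: (phi j _) => a b; case: (phi j x) => c d /=.
  by rewrite mul0r addr0.
by apply/funext => h; rewrite !mxE fmorphV.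
Unshelve. all: by end_near. Qed.

(* By the chain rule the complex Jacobian matrix of [g] at [hmap phi x] is an
   inverse of the matrix of the [pderiv l (phi j) x]. *)
Lemma left_inverse_gradient_neq0 (g : 'I_n -> 'rV[C]_n -> C) (x : state) j :
  (forall k, entire (g k)) ->
  (forall k y, B y -> (y 0 k)%:C = g k (hmap phi y)) -> B x ->
  exists l, pderiv l (phi j) x != 0.
Proof.
move=> entg gh Bx; pose z := hmap phi x.
pose D k : 'rV[C]_n -> C := 'd (g k : 'rV[C]_n -> C^o) z.
(* The identity between the coordinate [k] and [g k] composed with [hmap phi] is differentiated in
   direction [l]: [h1] is the chain rule, while in [h2] the quotient of the coordinate is constant
   near 0. *)
have Dv k l : D k (\row_j pderiv l (phi j) x) = (k == l)%:R.
  have h1 : (h%:C : C)^-1 *: ((g k (hmap phi (x + h *: delta_mx 0 l)) : C^o) - g k z)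
    @[h --> (0 : R)^'] --> (D k (\row_j pderiv l (phi j) x) : C^o).
    apply: diff_quotient_cvg (hmap_partial_cvg Bx).
    - exact: entg.
    - exact: real_complex_cvg0.
    - by near=> h; rewrite fmorph_eq0; near: h; exact: nbhs_dnbhs_neq.
  have h2 : (h%:C : C)^-1 *: ((g k (hmap phi (x + h *: delta_mx 0 l)) : C^o) - g k z)
    @[h --> (0 : R)^'] --> ((k == l)%:R : C^o).
    apply: cvg_near_cst; near=> h.
    have h0 : h != 0 by near: h; exact: nbhs_dnbhs_neq.
    rewrite -gh; last by near: h; exact: near_line.
    rewrite -gh // -rmorphB /= -fmorphV.
    have -> (a b : C) : a *: (b : C^o) = a * b by [].
    rewrite -rmorphM /= !mxE eqxx /= [_ + h * _]addrC addrK mulKf //.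
    by rewrite -[in RHS](rmorph_nat (real_complex R)).
  exact: cvg_unique h1 h2.
pose Phi := \matrix_(l < n, j < n) pderiv l (phi j) x.
pose A := \matrix_(j < n, k < n) D k (delta_mx 0 j).
have PhiA : Phi *m A = 1%:M.
  apply/matrixP => l k; rewrite !mxE eq_sym -Dv [in RHS](row_sum_delta (\row_ _ _)).
  rewrite /D linear_sum; apply: eq_bigr => i _; rewrite linearZ /= !mxE.
  by [].
(* [Phi] is square, so [A *m Phi] is the identity as well; a vanishing gradient of [phi j] would
   make column [j] of [Phi] zero and with it the diagonal entry [(j, j)]. *)
apply: contrapT => h; have h0 l : pderiv l (phi j) x = 0.
  by apply/eqP; apply: contraT => hl; exfalso; apply: h; exists l.
have /matrixP/(_ j j) := mulmx1C PhiA; rewrite !mxE eqxx big1 => [|l _].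
  by move/eqP; rewrite eq_sym oner_eq0.
by rewrite !mxE h0 mulr0.
Unshelve. all: by end_near. Qed.

End left_inverse.

(* Since [phi j] has derivative [lam j * phi j x] along [F x], its modulus at
   [x - h F x + h d w] is, to first order in [h], at least
   [normc (phi j x) * (1 - h * Re (lam j)) - O(h d)]; where [phi j x = 0] it is
   [h d] times the modulus of the derivative along [w], which is nonzero for a
   generic [w]. *)
Lemma larger_moduli (F : state -> state) (S : R -> state -> state) (B : set state)
    (lam : 'I_n -> C) (phi : 'I_n -> state -> C) (x : state) :
  flow F S -> open B -> (forall j, smooth_on B (phi j)) ->
  (forall j, koopman_eigenfunction S B (lam j) (phi j)) ->
  (forall j, complex.Re (lam j) < 0) -> B x ->
  (forall j, exists l, pderiv l (phi j) x != 0) ->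
  exists2 y, B y & forall j, normc (phi j x) < normc (phi j y).
Proof.
move=> flowS oB sphi eig lam0 Bx grad.
have dphi j := smooth_cdifferentiable (sphi j) Bx.
have [w hw] := generic_direction grad.
have DF j := eigenfunction_cdifferential flowS (eig j) Bx (dphi j).
have {}hw j : cdifferential (phi j) x w != 0 by exact: hw.
(* Where [phi j x] is nonzero, [d] must be so small that the perturbation along [w] cannot outweigh
   the growth gained by moving against [F]. *)
have /ex_right_pos[d d0 hd] : \forall d \near (0 : R)^'+, forall j, phi j x != 0 ->
      d * normc (cdifferential (phi j) x w) < - complex.Re (lam j) * normc (phi j x).
    apply: filter_forall => j.
    have [->|phix0] := eqVneq (phi j x) 0; first by near=> d; move=> /eqP[].
    have K0 : 0 < normc (cdifferential (phi j) x w).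
      by rewrite lt_def normc_eq0 hw normc_ge0.
    have phix1 : 0 < normc (phi j x) by rewrite lt_def normc_eq0 phix0 normc_ge0.
    near=> d => _; rewrite -ltr_pdivlMr //; near: d; apply: nbhs_right_lt.
    by apply: divr_gt0 => //; apply: mulr_gt0; rewrite ?oppr_gt0.
pose v := d *: w - F x.
have Dv j : cdifferential (phi j) x v =
    d%:C * cdifferential (phi j) x w - lam j * phi j x.
  rewrite -DF -cdifferentialZ /cdifferential -sumrB; apply: eq_bigr => l _.
  by rewrite !mxE rmorphB /= mulrBr.
have small (P : set state) : (\forall h \near (0 : state), P h) ->
    \forall h \near (0 : R)^'+, P (h *: v).
  move=> h0P; have : h *: v @[h --> (0 : R)^'+] --> (0 : state).
    by rewrite -[X in _ --> X](scale0r v); apply: cvgZr_tmp; exact: cvg_within.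
  by move/(_ _ h0P).
have Bnear : \forall h \near (0 : R)^'+, B (x + h *: v).
  by apply: (small (fun h => B (x + h))); apply/(nbhs0P B x); exact: open_nbhs_nbhs.
have grow : \forall h \near (0 : R)^'+, forall j,
    normc (phi j x) < normc (phi j (x + h *: v)).
  apply: filter_forall => j.
  have [M [M0 /small hM]] := smooth_taylor2 oB Bx (sphi j).
  pose K := normc (cdifferential (phi j) x w).
  (* [c] is a lower bound for the first-order growth rate of the modulus of [phi j] along [v]; the
     Taylor remainder is then made smaller than [h * c]. *)
  pose c := if phi j x == 0 then d * K
            else - complex.Re (lam j) * normc (phi j x) - d * K.
  have c0 : 0 < c.
    rewrite /c; case: eqVneq => phix; last by rewrite subr_gt0 hd.
    by rewrite mulr_gt0 // lt_def normc_eq0 hw normc_ge0.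
  have M1 : 0 < M * `|v| ^+ 2 + 1 by rewrite ltr_wpDl // mulr_ge0 // exprn_ge0.
  near=> h.
  have h0 : 0 < h by [].
  have : normc (phi j (x + h *: v) - phi j x - cdifferential (phi j) x (h *: v))
    <= M * `|h *: v| ^+ 2 by near: h.
  rewrite cdifferentialZ Dv normrZ gtr0_norm // => hr.
  have lower (z r a : C) : z = a + r -> normc a - normc r <= normc z.
    move=> ->; rewrite lerBlDr -[normc r]normcN; apply: le_trans (normcD _ _).
    by rewrite addrK.
  have hc : M * (h * `|v|) ^+ 2 < h * c.
    rewrite exprMn mulrCA expr2 -mulrA ltr_pM2l //.
    apply: (@le_lt_trans _ _ (h * (M * `|v| ^+ 2 + 1))).
      by rewrite ler_pM2l // lerDl.
    by rewrite -ltr_pdivlMr //; near: h; apply: nbhs_right_lt; exact: divr_gt0.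
  have hdK (u : C) : normc (h%:C * (d%:C * u)) = h * (d * normc u).
    by rewrite !Normc.normcM !normcR !gtr0_norm.
  move: hc; rewrite /c; case: eqVneq => phix hc.
    rewrite phix mulr0 !subr0 in hr; rewrite phix Normc.normc0.
    set a := h%:C * (d%:C * cdifferential (phi j) x w) in hr.
    apply: lt_le_trans (lower _ (phi j (x + h *: v) - a) a _); last by ring.
    by rewrite hdK subr_gt0; apply: le_lt_trans hr hc.
  set r := (X in normc X) in hr.
  (* The factor [1 - h lam_j] is kept together because its modulus is at least its real part, which
     exceeds 1. *)
  have e1 : phi j (x + h *: v) = phi j x * (1 - h%:C * lam j) +
      (h%:C * (d%:C * cdifferential (phi j) x w) + r) by rewrite /r; ring.
  apply: lt_le_trans (lower _ _ _ e1); rewrite Normc.normcM.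
  have l1 : 1 - h * complex.Re (lam j) <= normc (1 - h%:C * lam j).
    apply: le_trans (Re_le_normc _); apply: le_trans (ler_norm _).
    by case: (lam j) => a b; rewrite /= mul0r subr0.
  have l2 := normcD (h%:C * (d%:C * cdifferential (phi j) x w)) r.
  rewrite hdK in l2.
  have l3 := ler_wpM2l (normc_ge0 (phi j x)) l1.
  rewrite -/K in l2; nra.
have [h [hB hg]] := filter_ex (filterI Bnear grow).
by exists (x + h *: v).
Unshelve. all: by end_near. Qed.

End directional.

(** * The mode expansion near a point of the basin *)

Section koopman.
Variables (R : realType) (n : nat).
Local Notation C := R[i].
Local Notation state := 'rV[R]_n.
Variables (S : R -> state -> state) (xs : state) (lam : 'I_n -> C).
Variables (phi : 'I_n -> state -> C) (V : 'I_n -> 'rV[C]_n) (W : hindex n -> 'rV[C]_n).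
Local Notation B := (basin S xs).
Hypothesis modes : koopman_modes S xs lam phi V W.

Lemma modes_coord (x : state) (t : R) k : B x -> 0 <= t ->
  has_sum (fun a : hindex n => cexp (lam_h lam a * t%:C) * W a 0 k * phi_h phi a x)
    ((S t x 0 k)%:C - (xs 0 k)%:C
     - \sum_(j < n) cexp (lam j * t%:C) * V j 0 k * phi j x).
Proof.
move=> Bx t0; have h := @modes _ _ Bx t0.
have := cvg_comp _ _ h (@coord_continuous C 1 n 0 k _).
rewrite !mxE summxE.
rewrite (_ : \sum_(j < n) _ = \sum_(j < n) cexp (lam j * t%:C) * V j 0 k * phi j x).
  rewrite /has_sum (_ : _ \o _ = partial_sum (fun a : hindex n =>
    cexp (lam_h lam a * t%:C) * W a 0 k * phi_h phi a x : C^o)) //.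
  apply/funext => J; rewrite /= !partial_sumE summxE; apply: eq_bigr => a _.
  by rewrite mxE mulrAC.
by apply: eq_bigr => j _; rewrite mxE mulrAC.
Qed.

(** Subtracting the expansions at [x + dx] and [x] removes [xs] and leaves an exact identity, linear
    in the increments of the eigenfunctions. *)
Lemma modes_increment (x dx : state) (t : R) k : B x -> B (x + dx) -> 0 <= t ->
  has_sum (fun a : hindex n =>
      cexp (lam_h lam a * t%:C) * W a 0 k * dz0_h phi x a dx)
    (dX S t x k dx - \sum_(j < n) cexp (lam j * t%:C) * V j 0 k * dz0 phi x j dx).
Proof.
move=> Bx Bxd t0.
have := has_sumB (modes_coord (k := k) Bxd t0) (modes_coord (k := k) Bx t0).
rewrite (_ : (fun a : hindex n => _ - _) = fun a : hindex n =>
    cexp (lam_h lam a * t%:C) * W a 0 k * dz0_h phi x a dx); last first.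
  by apply/funext => a; rewrite -mulrBr.
congr has_sum; rewrite [in RHS](eq_bigr (fun j =>
    cexp (lam j * t%:C) * V j 0 k * phi j (x + dx) -
    cexp (lam j * t%:C) * V j 0 k * phi j x)) => [|j _]; last by rewrite -mulrBr.
by rewrite sumrB /dX rmorphB /=; ring.
Qed.

Lemma modes_increment0 (x dx : state) k : (forall z, S 0 z = z) ->
  B x -> B (x + dx) ->
  has_sum (fun a : hindex n => W a 0 k * dz0_h phi x a dx)
    ((dx 0 k)%:C - \sum_(j < n) V j 0 k * dz0 phi x j dx).
Proof.
move=> S0 Bx Bxd; have := modes_increment (k := k) Bx Bxd (lexx 0).
rewrite /dX !S0 mxE [_ + dx 0 k]addrC addrK.
rewrite (eq_bigr (fun j => V j 0 k * dz0 phi x j dx)) => [|j _]; last first.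
  by rewrite mulr0 cexp0 mul1r.
by congr has_sum; apply/funext => a; rewrite mulr0 cexp0 mul1r.
Qed.

Lemma Re_lam_h_le0 (a : hindex n) : (forall j, complex.Re (lam j) < 0) ->
  complex.Re (lam_h lam a) <= 0.
Proof.
move=> lam0; rewrite Re_sum; apply: sumr_le0 => i _.
elim: (val a i) => [|m IH]; first by rewrite mulr0n.
by rewrite mulrS raddfD /=; have := lam0 i; lra.
Qed.

(** The majorant [rho a] is the monomial in the enlarged moduli [normc (phi i x) + d], which the
    modulus of [phi_h phi a y] dominates. The expansion at [y] and time 0 converges absolutely, and
    since the exponentials have modulus at most 1 its bound carries over to every later time. *)
Lemma koopman_modes_dominated (x y : state) (eta d : R) :
  0 < eta -> (forall j, complex.Re (lam j) < 0) -> B y ->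
  (forall j, normc (phi j x) + d <= normc (phi j y)) ->
  (forall j, jet x eta (normc (phi j x)) (normc (phi j x) + d) (phi j)) ->
  exists rho : hindex n -> R,
    (forall a : hindex n,
       jet x eta (\prod_(i < n) normc (phi i x) ^+ val a i) (rho a)
         (phi_h phi a)) /\
    forall (t : R) k, 0 <= t -> exists M : R, 0 <= M /\
      abs_bounded (fun a : hindex n =>
      (rho a)%:C * (cexp (lam_h lam a * t%:C) * W a 0 k)) M.
Proof.
move=> eta0 lam0 By dy hj.
exists (fun a : hindex n => \prod_(i < n) (normc (phi i x) + d) ^+ val a i); split.
  by move=> a; apply: jet_prod => // i; apply: jetX.
move=> t k t0.
have [M hM] := has_sum_abs_bounded (modes_coord (k := k) By (lexx 0)).
exists M; split; first by have := hM fset0; rewrite big_seq_fset0.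
apply: abs_bounded_le hM => a.
have rge0 i : 0 <= normc (phi i x) + d.
  by have [_ /andP[h0 h1] _ _] := hj i; exact: le_trans h1.
rewrite mulr0 cexp0 mul1r [W a 0 k * _]mulrC Normc.normcM [leRHS]Normc.normcM.
apply: ler_pM; rewrite ?normc_ge0 //.
  rewrite normcR ger0_norm; last by apply: prodr_ge0 => i _; exact: exprn_ge0.
  rewrite normc_prod; apply: ler_prod => i _.
  by rewrite exprn_ge0 //= normcX lerXn2r // nnegrE ?normc_ge0.
rewrite Normc.normcM ler_piMl ?normc_ge0 //.
exact/normc_cexp_le1/Re_lam_h_le0.
Qed.

Hypothesis lam_neg : forall j, complex.Re (lam j) < 0.
Hypothesis eig : forall j, koopman_eigenfunction S B (lam j) (phi j).
Hypothesis openB : open B.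
Hypothesis smooth_phi : forall j, smooth_on B (phi j).

Lemma dZ_approx (x : state) (t : R) j : (forall z, S 0 z = z) -> B x -> 0 <= t ->
  (forall dx : state, B (x + dx) ->
    summable_h (fun a : hindex n =>
      \sum_(k < n) GPh_mode phi W a j k x * dz0_h phi x a dx)) /\
  approx2 B x (dZ S phi t x j)
    (fun dx : state =>
       cexp (lam j * t%:C) * (\sum_(k < n) PF phi V j k x * dz0 phi x j dx)
       + cexp (lam j * t%:C) *
           (\sum_(i < n | i != j) \sum_(k < n)
              GP_mode phi V i j k x * dz0 phi x i dx)
       + cexp (lam j * t%:C) *
           sum_h (fun a : hindex n =>
             \sum_(k < n) GPh_mode phi W a j k x * dz0_h phi x a dx)).
Proof.
move=> S0 Bx t0.
have hs (dx : state) : B (x + dx) -> has_sum (fun a : hindex n =>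
    \sum_(k < n) GPh_mode phi W a j k x * dz0_h phi x a dx)
    (\sum_(k < n) pderiv k (phi j) x *
       ((dx 0 k)%:C - \sum_(i < n) V i 0 k * dz0 phi x i dx)).
  move=> Bxd; apply: has_sum_sum => k _.
  have := has_sumMl (c := pderiv k (phi j) x) (modes_increment0 (k := k) S0 Bx Bxd).
  by congr has_sum; apply/funext => a; rewrite mulrA.
split=> [dx /hs /has_sum_cvg //|].
have [M [M0 hM]] := smooth_taylor2 openB Bx (smooth_phi j).
(* [dZ] is the exponential times the increment of [phi j], and the right side is the exponential
   times its differential, so only the Taylor constant [M] gets scaled. *)
exists (normc (cexp (lam j * t%:C)) * M); apply: filterS hM => dx hM Bxd.
rewrite /sum_h (has_sum_unique (hs dx Bxd)).
set e := cexp _.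
rewrite (_ : _ - _ = e * (phi j (x + dx) - phi j x - cdifferential (phi j) x dx)).
  by rewrite normcE lecR Normc.normcM -mulrA ler_wpM2l ?normc_ge0.
have [_ eigj] := eig j.
have -> : dZ S phi t x j dx = e * phi j (x + dx) - e * phi j x.
  by rewrite /dZ -!eigj.
rewrite -mulrBr -!mulrDr -mulrBr; congr (_ * (_ - _)).
(* The term of [PF] is the missing index [i = j]; the completed sum over [i] cancels the [V] part of
   the series, leaving the differential. *)
transitivity (\sum_(i < n) \sum_(k < n) GP_mode phi V i j k x * dz0 phi x i dx +
  \sum_(k < n) pderiv k (phi j) x *
       ((dx 0 k)%:C - \sum_(i < n) V i 0 k * dz0 phi x i dx)).
  by rewrite [in RHS](bigD1 j).
rewrite exchange_big -big_split; apply: eq_bigr => k _ /=.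
rewrite mulrBr mulr_sumr [X in X + _](eq_bigr (fun i =>
  pderiv k (phi j) x * (V i 0 k * dz0 phi x i dx))) => [|i _]; last by rewrite mulrA.
by rewrite addrC subrK.
Qed.

Lemma dX_approx (F : state -> state) (x : state) (t : R) k :
  flow F S -> (forall j, exists l, pderiv l (phi j) x != 0) ->
  B x -> 0 <= t ->
  (forall l, summable_h (fun a : hindex n =>
     cexp (lam_h lam a * t%:C) * GPh_state phi W a k l x)) /\
  approx2 B x (dX S t x k)
    (fun dx : state =>
       \sum_(j < n) cexp (lam j * t%:C) * PF phi V j k x * (dx 0 k)%:C
       + \sum_(l < n | l != k) \sum_(j < n)
           cexp (lam j * t%:C) * GP_state phi V j k l x * (dx 0 l)%:C
       + sum_h (fun a : hindex n =>
           cexp (lam_h lam a * t%:C) * PFh phi W a k x * (dx 0 k)%:C)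
       + \sum_(l < n | l != k) sum_h (fun a : hindex n =>
           cexp (lam_h lam a * t%:C) * GPh_state phi W a k l x
           * (dx 0 l)%:C)).
Proof.
move=> flowS grad Bx t0.
have [y By lty] := larger_moduli flowS openB smooth_phi eig lam_neg Bx grad.
(* [d] is a common slack keeping the enlarged moduli at [x] below those at [y]; [r] is then a common
   radius for the jets with this slack. *)
have /ex_right_pos[d d0 hd] :
    \forall d \near (0 : R)^'+, forall j, normc (phi j x) + d <= normc (phi j y).
  apply: filter_forall => j.
  have c0 : 0 < normc (phi j y) - normc (phi j x) by rewrite subr_gt0.
  near=> d; rewrite -lerBrDl; near: d; exact: nbhs_right_le.
have /ex_right_pos[r r0 hj] : \forall r \near (0 : R)^'+, forall j,
    jet x r (normc (phi j x)) (normc (phi j x) + d) (phi j).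
  by apply: filter_forall => j; exact: smooth_jet openB Bx (smooth_phi j) d0.
have [rho [hrho /(_ t k t0)[M [M0 hM]]]] :=
  koopman_modes_dominated r0 lam_neg By hd hj.
have rho0 (a : hindex n) : 0 <= rho a.
  by have [_ /andP[b0 br] _ _] := hrho a; apply: le_trans br.
(* Comparison with the majorant, used twice: with [q = r^-1] for the partial derivatives of the
   monomials and with [q = (|dx| / r) ^ 2] for their Taylor remainders. *)
have dom (q : R) (u : hindex n -> C) :
    0 <= q -> (forall a : hindex n, normc (u a) <= q * rho a) ->
    abs_bounded (fun a : hindex n =>
      cexp (lam_h lam a * t%:C) * W a 0 k * u a) (q * M).
  move=> q0 hu J; apply: le_trans (ler_wpM2l q0 (hM J)); rewrite mulr_sumr.
  apply: ler_sum => a _; rewrite mulrC Normc.normcM [in leRHS]Normc.normcM mulrA.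
  by rewrite ler_wpM2r ?normc_ge0 // normcR (ger0_norm (rho0 a)).
have /choice[s hs] : forall l, exists s, has_sum (fun a : hindex n =>
    cexp (lam_h lam a * t%:C) * GPh_state phi W a k l x) s.
  move=> l; have r1 : 0 <= r^-1 by rewrite invr_ge0 ltW.
  have [s hs] := abs_bounded_has_sum (dom _ _ r1
    (fun a => jet_pderiv_le l r0 (hrho a))).
  exists s; move: hs; congr has_sum; apply/funext => a.
  by rewrite -mulrA [W a 0 k * _]mulrC.
split; first by move=> l; exact: has_sum_cvg (hs l).
pose e (j : 'I_n) := cexp (lam j * t%:C) * V j 0 k.
(* Each linear mode contributes its jet remainder, weighted by [e j] and of slack [d]; [M] bounds
   all higher modes at once. *)
exists (r^-1 ^+ 2 * (\sum_j normc (e j) * d + M)).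
have : \forall dx \near (0 : state), `|dx| <= r.
  apply/nbhs_ballP; exists r => //= dx; rewrite -ball_normE /= sub0r normrN; exact: ltW.
apply: filterS => dx hdx Bxd.
have sumE l : sum_h (fun a : hindex n =>
    cexp (lam_h lam a * t%:C) * GPh_state phi W a k l x * (dx 0 l)%:C) =
    s l * (dx 0 l)%:C.
  exact: has_sum_unique (has_sumMr (hs l)).
rewrite (sumE k) (eq_bigr _ (fun l _ => sumE l)).
set lin := (X in _ - X).
(* The terms with [l = k], written separately in the statement, are put back into the sums over all
   [l]. *)
have -> : lin = \sum_(j < n) e j * cdifferential (phi j) x dx
    + \sum_(l < n) s l * (dx 0 l)%:C.
  rewrite /lin -addrA; congr (_ + _); last by rewrite [in RHS](bigD1 k).
  rewrite /cdifferential; under [in RHS]eq_bigr => j _ do rewrite mulr_sumr.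
  rewrite [in RHS]exchange_big [in RHS](bigD1 k) //=.
  by congr (_ + _); do ?[apply: eq_bigr => ? _]; rewrite /PF /GP_state /e; ring.
have hT := modes_increment (k := k) Bx Bxd t0.
have hD : has_sum (fun a : hindex n => cexp (lam_h lam a * t%:C) * W a 0 k *
    cdifferential (phi_h phi a) x dx) (\sum_(l < n) s l * (dx 0 l)%:C).
  have := has_sum_sum (r := index_enum 'I_n) (P := xpredT)
    (fun l _ => has_sumMr (c := (dx 0 l)%:C) (hs l)).
  congr has_sum; apply/funext => a; rewrite mulr_sumr; apply: eq_bigr => l _.
  by rewrite /GPh_state; ring.
have q0 : 0 <= (`|dx| / r) ^+ 2 by rewrite exprn_ge0 // divr_ge0 // ltW.
have hb : abs_bounded (fun a : hindex n =>
    cexp (lam_h lam a * t%:C) * W a 0 k * dz0_h phi x a dx -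
    cexp (lam_h lam a * t%:C) * W a 0 k * cdifferential (phi_h phi a) x dx)
    ((`|dx| / r) ^+ 2 * M).
  rewrite (_ : (fun a : hindex n => _ - _) = fun a : hindex n =>
     cexp (lam_h lam a * t%:C) * W a 0 k *
       (dz0_h phi x a dx - cdifferential (phi_h phi a) x dx)); last first.
    by apply/funext => a; rewrite [in RHS]mulrBr.
  apply: dom => // a; have [_ /andP[b0 _] _ /(_ dx hdx)[_ _]] := hrho a.
  by move=> /le_trans; apply; rewrite ler_wpM2l // gerBl.
have hR := has_sum_le (has_sumB hT hD) hb.
rewrite normcE lecR; set T := (X in normc X) in hR.
have -> : dX S t x k dx - (\sum_(j < n) e j * cdifferential (phi j) x dx +
    \sum_(l < n) s l * (dx 0 l)%:C) =
  \sum_(j < n) e j * (dz0 phi x j dx - cdifferential (phi j) x dx) + T.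
  under [in RHS]eq_bigr => j _ do rewrite mulrBr.
  by rewrite sumrB /T /e; ring.
apply: le_trans (normcD _ _) _.
have -> : r^-1 ^+ 2 * (\sum_j normc (e j) * d + M) * `|dx| ^+ 2 =
    \sum_j normc (e j) * ((`|dx| / r) ^+ 2 * d) + (`|dx| / r) ^+ 2 * M.
  rewrite mulrDr mulrDl mulr_sumr mulr_suml; congr (_ + _).
    by apply: eq_bigr => j _; rewrite exprMn; ring.
  by rewrite exprMn; ring.
apply: lerD hR; apply: le_trans (normc_sum _ _ _) (ler_sum _ _) => j _.
rewrite Normc.normcM ler_wpM2l ?normc_ge0 //.
have [_ _ _ /(_ dx hdx)[_ _]] := hj j.
by rewrite [normc (phi j x) + d]addrC addrK.
Unshelve. all: by end_near. Qed.

End koopman.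

Theorem theorem1 (R : realType) (n : nat)
    (F : 'rV[R]_n -> 'rV[R]_n) (S : R -> 'rV[R]_n -> 'rV[R]_n)
    (xs : 'rV[R]_n) (lam : 'I_n -> R[i]) (phi : 'I_n -> 'rV[R]_n -> R[i])
    (V : 'I_n -> 'rV[R[i]]_n) (W : hindex n -> 'rV[R[i]]_n)
    (F_analytic : analytic F)
    (S_flow : flow F S)
    (xs_equilibrium : F xs = 0)
    (xs_stable : asymptotically_stable S xs)
    (basin_open : open (basin S xs))
    (lam_eigenvalue : forall j : 'I_n,
       eigenvalue (map_mx (real_complex R) ('J F xs)) (lam j))
    (lam_distinct : injective lam)
    (lam_neg : forall j : 'I_n, complex.Re (lam j) < 0)
    (lam_nonresonant : nonresonant lam)
    (phi_smooth : forall j : 'I_n, smooth_on (basin S xs) (phi j))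
    (phi_eigenfunction : forall j : 'I_n,
       koopman_eigenfunction S (basin S xs) (lam j) (phi j))
    (phi_conjugacy : diagonal_conjugacy S (basin S xs) lam (hmap phi))
    (coordinates_observable : forall k : 'I_n,
       observable_space (basin S xs) (hmap phi)
         (fun x : 'rV[R]_n => (x 0 k)%:C))
    (modes : koopman_modes S xs lam phi V W) :
  forall (x0 : 'rV[R]_n) (t : R), basin S xs x0 -> 0 <= t ->
  (forall k : 'I_n,
    (forall l : 'I_n, summable_h (fun a : hindex n =>
       cexp (lam_h lam a * t%:C) * GPh_state phi W a k l x0)) /\
    summable_h (fun a : hindex n =>
       cexp (lam_h lam a * t%:C) * PFh phi W a k x0) /\
    approx2 (basin S xs) x0 (dX S t x0 k)
      (fun dx : 'rV[R]_n =>
         \sum_(j < n) cexp (lam j * t%:C) * PF phi V j k x0 * (dx 0 k)%:C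
         + \sum_(l < n | l != k) \sum_(j < n)
             cexp (lam j * t%:C) * GP_state phi V j k l x0 * (dx 0 l)%:C
         + sum_h (fun a : hindex n =>
             cexp (lam_h lam a * t%:C) * PFh phi W a k x0 * (dx 0 k)%:C)
         + \sum_(l < n | l != k) sum_h (fun a : hindex n =>
             cexp (lam_h lam a * t%:C) * GPh_state phi W a k l x0
             * (dx 0 l)%:C)))
  /\
  (forall j : 'I_n,
    (forall dx : 'rV[R]_n, basin S xs (x0 + dx) ->
       summable_h (fun a : hindex n =>
         \sum_(k < n) GPh_mode phi W a j k x0 * dz0_h phi x0 a dx)) /\
    approx2 (basin S xs) x0 (dZ S phi t x0 j)
      (fun dx : 'rV[R]_n =>
         cexp (lam j * t%:C) * (\sum_(k < n) PF phi V j k x0 * dz0 phi x0 j dx)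
         + cexp (lam j * t%:C) *
             (\sum_(i < n | i != j) \sum_(k < n)
                GP_mode phi V i j k x0 * dz0 phi x0 i dx)
         + cexp (lam j * t%:C) *
             sum_h (fun a : hindex n =>
               \sum_(k < n) GPh_mode phi W a j k x0 * dz0_h phi x0 a dx))).
Proof.
move=> x0 t Bx t0.
have S0 z : S 0 z = z by have [[]] := S_flow z.
(* Expressing the coordinates as entire functions of the eigenfunctions gives a holomorphic left
   inverse of [hmap phi] on the basin, hence nonzero gradients. *)
have /choice[g hg] : forall k : 'I_n, exists g : 'rV[R[i]]_n -> R[i],
    entire g /\ forall x, basin S xs x -> (x 0 k)%:C = g (hmap phi x).
  by move=> k; have [g [eg _] gx] := coordinates_observable k; exists g.
have grad j : exists l, pderiv l (phi j) x0 != 0.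
  exact: (left_inverse_gradient_neq0 basin_open phi_smooth j
    (fun k => (hg k).1) (fun k => (hg k).2) Bx).
split=> [k|j].
  have [summ approx] := dX_approx modes lam_neg phi_eigenfunction
    basin_open phi_smooth k S_flow grad Bx t0.
  (* [PFh] is [GPh_state] at [l = k]. *)
  by split=> //; split=> //; exact: summ k.
exact: (dZ_approx modes phi_eigenfunction basin_open phi_smooth j S0 Bx t0).
Qed.
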